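(* Let $d\ge 1$, $Y=(0,\infty)\times\mathbb{R}^d$, and let $a$ be the hard spheres aggregation rate $$a(y,y')=a_{HS}(y,y')=(m^{1/3}+m'^{1/3})^2\,|v-v'|,\qquad y=(m,p),\ y'=(m',p')\in Y,\ v=p/m,\ v'=p'/m'.$$ Let $0\le f_{in}\in L^1(Y;k_S^2(y)\,dy)$ be even in the $p$ variable, with $k_S(y)=1+m+|p|+|v|$, and let $f$ be the unique solution, $f\in C([0,T);L^1(Y;k_S\,dy))\cap L^\infty(0,T;L^1(Y;k_S^2\,dy))$ for all $T>0$, of the ballistic aggregation equation $\partial_t f=Q(f)$ with initial datum $f(0)=f_{in}$ and rate $a_{HS}$. Define $$M_{-1/3,1}(t):=\int_Y m^{-1/3}\,|p|\,f(t,y)\,dy .$$ Then $A^{-1}:=M_{-1/3,1}(0)<\infty$ and $$M_{-1/3,1}(t)\le \frac{1}{A+t/4}\qquad\text{for all } t\ge 0$$ (if $M_{-1/3,1}(0)=0$, one reads $A=+\infty$ and the right-hand side as $0$).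
   Context: A particle is described by $y=(m,p)\in Y=(0,\infty)\times\mathbb{R}^d$ (mass $m$, impulsion $p$), with velocity $v=p/m$ and $dy=dm\,dp$. For a symmetric rate $a(y,y')\ge 0$ the ballistic aggregation equation is $\partial_t f=Q(f)$, $f(0)=f_{in}$, for a density $f=f(t,y)\ge 0$, where $Q(f)=Q_1(f)-Q_2(f)$ with $$Q_1(f)(y)=\frac12\int_{\mathbb{R}^d}\int_0^m a(y',y-y')\,f(y')\,f(y-y')\,dm'\,dp',\qquad Q_2(f)(y)=\int_{\mathbb{R}^d}\int_0^\infty a(y,y')\,f(y)\,f(y')\,dm'\,dp'.$$ The equation is understood in the sense of distributions. ''Even in $p$'' means $f(m,-p)=f(m,p)$. It is known (earlier work) that for $a=a_{HS}$ and any even $0\le f_{in}\in L^1(Y;k_S^2\,dy)$ there is a unique solution $f\in C([0,T);L^1(Y;k_S\,dy))\cap L^\infty(0,T;L^1(Y;k_S^2\,dy))$ for all $T>0$, and that $f(t,\cdot)$ is nonnegative and even in $p$ for all $t\ge0$, has constant mass $\int_Y m f(t,y)\,dy$, and satisfies $\int_Y |v|^k f(t,y)\,dy\le\int_Y |v|^k f_{in}(y)\,dy$ for all $k>0$ and $\int_Y |p|^2 f(t,y)\,dy\le\int_Y |p|^2 f_{in}(y)\,dy$. *)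

(* Defs.v *)
From HB Require Import structures.
From mathcomp Require Import all_boot all_order all_algebra.
From mathcomp Require Import all_classical all_reals all_analysis.

Set Implicit Arguments.
Unset Strict Implicit.
Unset Printing Implicit Defensive.

Import Order.TTheory GRing.Theory Num.Theory.
Import numFieldNormedType.Exports.

Local Open Scope classical_set_scope.
Local Open Scope ring_scope.

Definition measure_rV_display : measure_display -> measure_display.
Proof. exact. Qed.

(* The sigma-algebra on T^n generated by the coordinates, as the library does
   for n.-tuple T; for T = R it is the Borel sigma-algebra of R^n. *)
Section measurable_rV.
Context {d} {T : sigmaRingType d}.
Variable n : nat.

Let coors : 'I_n -> 'rV[T]_n -> T := fun i p => p ord0 i.

Let rV_set0 : g_sigma_preimage coors set0.
Proof. exact: sigma_algebra0. Qed.

Let rV_setC A : g_sigma_preimage coors A -> g_sigma_preimage coors (~` A).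
Proof. exact: sigma_algebraC. Qed.

Let rV_bigcup (F : _^nat) : (forall i, g_sigma_preimage coors (F i)) ->
  g_sigma_preimage coors (\bigcup_i (F i)).
Proof. exact: sigma_algebra_bigcup. Qed.

HB.instance Definition _ := @isMeasurable.Build (measure_rV_display d)
  'rV[T]_n (g_sigma_preimage coors) rV_set0 rV_setC rV_bigcup.

End measurable_rV.

Lemma measurable_rV_coord d (T : sigmaRingType d) n (i : 'I_n) :
  measurable_fun [set: 'rV[T]_n] (fun p : 'rV[T]_n => p ord0 i).
Proof.
move=> _ Y mY; rewrite setTI; apply: sub_sigma_algebra => /=.
rewrite -bigcup_seq/=; exists i => /=; first by rewrite mem_index_enum.
by exists Y => //; rewrite setTI.
Qed.

Lemma measurable_fun_rVP d1 d2 (T1 : measurableType d1) (T2 : measurableType d2)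
    n (f : T1 -> 'rV[T2]_n) :
  measurable_fun [set: T1] f <->
  forall i, measurable_fun [set: T1] (fun x => f x ord0 i).
Proof.
split=> [mf i|mf].
  exact: (measurableT_comp (@measurable_rV_coord _ T2 n i) mf).
move=> _; apply: (@smallest_sub _ _ _ [set A | measurable (setT `&` f @^-1` A)]).
  split => /=.
  - by rewrite preimage_set0 setI0.
  - by move=> A; rewrite !setTI => mA; rewrite setTD preimage_setC; exact: measurableC.
  - move=> F mF; rewrite setTI preimage_bigcup; apply: bigcup_measurable => k _.
    by have := mF k; rewrite /= setTI.
move=> A; rewrite -bigcup_seq => -[i _ [B mB <-]] /=.
rewrite [X in f @^-1` X]setTI.
exact: mf.
Qed.

Section lebesgue_measure_rV.
Variable R : realType.

Definition cons_rV n (xp : R * 'rV[R]_n) : 'rV[R]_n.+1 :=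
  row_mx (xp.1)%:M xp.2 : 'rV[R]_(1 + n).

Definition uncons_rV n (p : 'rV[R]_n.+1) : R * 'rV[R]_n :=
  (p ord0 ord0, \row_i p ord0 (lift ord0 i)).

Lemma cons_rV0 n xp : @cons_rV n xp ord0 ord0 = xp.1.
Proof.
transitivity ((row_mx (xp.1)%:M xp.2 : 'rV_(1 + n)) ord0 (lshift n ord0)).
  by congr (fun_of_matrix _ _ _); exact/val_inj.
by rewrite row_mxEl mxE eqxx mulr1n.
Qed.

Lemma cons_rVS n xp i : @cons_rV n xp ord0 (lift ord0 i) = xp.2 ord0 i.
Proof.
transitivity ((row_mx (xp.1)%:M xp.2 : 'rV_(1 + n)) ord0 (rshift 1 i)).
  by congr (fun_of_matrix _ _ _); exact/val_inj.
by rewrite row_mxEr.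
Qed.

Lemma cons_rVK n : cancel (@cons_rV n) (@uncons_rV n).
Proof.
move=> [x p]; rewrite /uncons_rV cons_rV0; congr pair.
by apply/rowP => i; rewrite mxE cons_rVS.
Qed.

Lemma uncons_rVK n : cancel (@uncons_rV n) (@cons_rV n).
Proof.
move=> p; apply/rowP => i.
by case: (unliftP ord0 i) => [j|] ->; rewrite ?cons_rVS ?cons_rV0 //= mxE.
Qed.

Lemma measurable_cons_rV n : measurable_fun setT (@cons_rV n).
Proof.
apply/measurable_fun_rVP => i.
case: (unliftP ord0 i) => [j|] ->.
  under eq_fun do rewrite cons_rVS.
  exact: (measurableT_comp (@measurable_rV_coord _ _ n j)).
by under eq_fun do rewrite cons_rV0; exact: measurable_fst.
Qed.

Lemma measurable_uncons_rV n : measurable_fun setT (@uncons_rV n).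
Proof.
apply/measurable_fun_pair; first exact: measurable_rV_coord.
apply/measurable_fun_rVP => i.
by under eq_fun do rewrite mxE; exact: measurable_rV_coord.
Qed.

Lemma measurable_cons_rV_TypeR n :
  measurable_fun setT (@cons_rV n : measurableTypeR R * 'rV[R]_n -> _).
Proof. exact: measurable_cons_rV. Qed.

Section step.
Variables (n : nat) (mu : {sigma_finite_measure set 'rV[R]_n -> \bar R}).

Definition lebesgue_step : set 'rV[R]_n.+1 -> \bar R :=
  pushforward (lebesgue_measure \x mu)%E (@cons_rV n).

Let mpre A : measurable A -> measurable (@cons_rV n @^-1` A : set (measurableTypeR R * _)).
Proof.
by move=> mA; rewrite -[X in measurable X]setTI; exact: measurable_cons_rV_TypeR.
Qed.

Let lebesgue_step0 : lebesgue_step set0 = 0%E.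
Proof. by rewrite /lebesgue_step /pushforward preimage_set0 measure0. Qed.

Let lebesgue_step_ge0 A : (0 <= lebesgue_step A)%E.
Proof. by rewrite /lebesgue_step /pushforward measure_ge0. Qed.

Let lebesgue_step_sigma_additive : semi_sigma_additive lebesgue_step.
Proof.
move=> F mF tF mUF; rewrite /lebesgue_step /pushforward preimage_bigcup.
apply: measure_semi_sigma_additive.
- by move=> k; exact: mpre.
- apply/trivIsetP => /= i j _ _ ij; rewrite -preimage_setI.
  by move/trivIsetP : tF => /(_ _ _ _ _ ij) ->//; rewrite preimage_set0.
- by rewrite -preimage_bigcup; exact: mpre.
Qed.

HB.instance Definition _ := isMeasure.Build _ _ _ lebesgue_step
  lebesgue_step0 lebesgue_step_ge0 lebesgue_step_sigma_additive.

Let lebesgue_step_sigma_finite : sigma_finite setT lebesgue_step.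
Proof.
have /sigma_finiteP[F [TF ndF Foo]] := sigma_finiteT (@lebesgue_measure R).
have /sigma_finiteP[G [TG ndG Goo]] := sigma_finiteT mu.
exists (fun k => @uncons_rV n @^-1` (F k `*` G k)).
  rewrite -preimage_bigcup (_ : \bigcup_k (F k `*` G k) = setT) ?preimage_setT//.
  rewrite -setXTT TF TG predeqE => -[x y]; split => [[k _ []/= ? ?]|].
    by split; exists k.
  move=> [/= [k _ Fkx] [l _ Gly]]; exists (maxn k l) => //; split.
  - by move: x Fkx; exact/subsetPset/ndF/leq_maxl.
  - by move: y Gly; exact/subsetPset/ndG/leq_maxr.
move=> k; have [mF Fk] := Foo k; have [mG Gk] := Goo k; split.
  rewrite -[X in measurable X]setTI; apply: measurable_uncons_rV => //.
  exact: measurableX.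
rewrite /lebesgue_step /pushforward -comp_preimage.
rewrite (_ : _ \o _ = id); last by apply/funext => x /=; rewrite cons_rVK.
by rewrite preimage_id product_measure1E// lte_mul_pinfty// ge0_fin_numE.
Qed.

HB.instance Definition _ := @Measure_isSigmaFinite.Build _ _ _
  lebesgue_step lebesgue_step_sigma_finite.

End step.

(* Lebesgue measure on R^n, as the n-fold product of Lebesgue measure on R. *)
Fixpoint lebesgue_rV n : {sigma_finite_measure set 'rV[R]_n -> \bar R} :=
  if n is n'.+1 then lebesgue_step (lebesgue_rV n') else \d_(0 : 'rV[R]_0).

Lemma measurable_box n (A : 'I_n -> set R) : (forall i, measurable (A i)) ->
  measurable [set p : 'rV[R]_n | forall i, A i (p ord0 i)].
Proof.
move=> mA; rewrite (_ : mkset _ =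
    \bigcap_(i in [set: 'I_n]) ((fun p : 'rV[R]_n => p ord0 i) @^-1` A i)).
  apply: fin_bigcap_measurable => // i _.
  by rewrite -[X in measurable X]setTI; exact: measurable_rV_coord.
by apply/seteqP; split => [p pA i _|p pA i]; exact: pA.
Qed.

Lemma lebesgue_rV_box n (A : 'I_n -> set R) : (forall i, measurable (A i)) ->
  lebesgue_rV n [set p | forall i, A i (p ord0 i)] =
  (\prod_(i < n) lebesgue_measure (A i))%E.
Proof.
elim: n A => [|n IHn] A mA.
  by rewrite big_ord0 /= diracE mem_set// => -[].
rewrite big_ord_recl -IHn//= /lebesgue_step /pushforward.
have mA' : measurable [set p : 'rV[R]_n | forall i, A (lift ord0 i) (p ord0 i)].
  by apply: (@measurable_box _ (fun i => A (lift ord0 i))) => i.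
rewrite -product_measure1E; [|exact: mA|exact: mA'].
congr (_ _); apply/seteqP; split=> -[x p] /=.
  move=> pA; split; first by have := pA ord0; rewrite cons_rV0.
  by move=> i; have := pA (lift ord0 i); rewrite cons_rVS.
by move=> [xA pA] i; case: (unliftP ord0 i) => [j|] ->; rewrite ?cons_rVS ?cons_rV0.
Qed.

End lebesgue_measure_rV.

Section ballistic_aggregation.
Variables (R : realType) (d : nat).

Local Notation state := (R * 'rV[R]_d)%type.
Implicit Types (y : state) (t T : R) (u w : state -> R).

(* The norm of 'rV[R]_d in the library is the sup norm. *)
Definition enorm (p : 'rV[R]_d) : R := Num.sqrt (\sum_(i < d) p ord0 i ^+ 2).

Definition velocity y : 'rV[R]_d := y.1^-1 *: y.2.

(* The functions below have domain R * R^d, but only their values on Y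
   matter. *)
Definition Y : set state := [set y | 0 < y.1].

Definition dy : {measure set (measurableTypeR R * 'rV[R]_d)%type -> \bar R} :=
  (lebesgue_measure \x lebesgue_rV R d)%E.

Definition aHS y y' : R :=
  (y.1 `^ (3^-1) + y'.1 `^ (3^-1)) ^+ 2 * enorm (velocity y - velocity y').

Definition kS y : R := 1 + y.1 + enorm y.2 + enorm (velocity y).

Definition Q1 (a : state -> state -> R) u y : R :=
  2^-1 * \int[dy]_(y' in [set y' | 0 < y'.1 < y.1])
           (a y' (y - y') * u y' * u (y - y')).

Definition Q2 (a : state -> state -> R) u y : R :=
  \int[dy]_(y' in Y) (a y y' * u y * u y').

Definition Q (a : state -> state -> R) u y : R := Q1 a u y - Q2 a u y.

Definition ae_nonneg u := {ae dy, forall y, Y y -> 0 <= u y}.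

Definition ae_even u := {ae dy, forall y, Y y -> u (y.1, - y.2) = u y}.

(* Elements of L^1(Y; w dy) are represented by functions; all the properties
   below depend only on their class modulo equality almost everywhere. *)
Definition inL1 w u := dy.-integrable Y (fun y => (w y * u y)%:E).

Definition L1norm w u : \bar R := \int[dy]_(y in Y) `|w y * u y|%:E.

Definition continuous_L1 (I : set R) w (f : R -> state -> R) :=
  (forall t, I t -> inL1 w (f t)) /\
  (forall t0, I t0 ->
    L1norm w (fun y => f t y - f t0 y) @[t --> within I (nbhs t0)] --> 0%E).

(* Finiteness of the essential supremum. Measurability of t |-> f t need not be
   required: this is only used for f continuous in time with values in a larger
   weighted L^1 space. *)
Definition bounded_L1 (I : set R) w (f : R -> state -> R) :=
  exists C : R, {ae lebesgue_measure, forall t : R, I t ->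
    inL1 w (f t) /\ (L1norm w (f t) <= C%:E)%E}.

Fixpoint iter_derive (V : normedModType R) (vs : seq V) (phi : V -> R) : V -> R :=
  if vs is v :: vs' then iter_derive vs' ('D_v phi) else phi.

Definition smooth (V : normedModType R) (phi : V -> R) :=
  forall vs : seq V, continuous (iter_derive vs phi) /\
    forall x v, derivable (iter_derive vs phi) x v.

(* C^oo_c(]0, +oo[ x Y), each function being extended by 0. *)
Definition test_function (phi : R * state -> R) :=
  smooth phi /\
  exists K : set (R * state),
    [/\ compact K, K `<=` [set ty | 0 < ty.1 /\ Y ty.2]
      & forall ty, ~ K ty -> phi ty = 0].

(* d_t f = Q(f) in the sense of distributions on ]0, +oo[ x Y. The integral is
   iterated, not over the product, so that it does not depend on the choice of
   a representative of f t for each t. *)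
Definition distributional_eq (a : state -> state -> R) (f : R -> state -> R) :=
  forall phi, test_function phi ->
    \int[lebesgue_measure]_(t in `]0, +oo[)
      (\int[dy]_(y in Y)
         (f t y * derive1 (fun s : R => phi (s, y)) t + Q a (f t) y * phi (t, y)))
    = 0 :> R.

Definition solution (a : state -> state -> R) (f_in : state -> R)
    (f : R -> state -> R) :=
  [/\ forall t, 0 <= t -> ae_nonneg (f t),
      forall T, 0 < T ->
        continuous_L1 `[0, T[ kS f /\ bounded_L1 `]0, T[ (fun y => kS y ^+ 2) f,
      {ae dy, forall y, Y y -> f 0 y = f_in y}
    & distributional_eq a f].

Definition unique_solution (a : state -> state -> R) (f_in : state -> R)
    (f : R -> state -> R) :=
  solution a f_in f /\
  forall g, solution a f_in g ->
    forall t, 0 <= t -> {ae dy, forall y, Y y -> g t y = f t y}.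

Definition moment (f : R -> state -> R) t : \bar R :=
  \int[dy]_(y in Y) (y.1 `^ (- 3^-1) * enorm y.2 * f t y)%:E.

End ballistic_aggregation.

(* Main.v *)
From HB Require Import structures.
From mathcomp Require Import all_boot all_order all_algebra.
From mathcomp Require Import all_classical all_reals all_analysis.
From mathcomp Require Import measurable_realfun.
From mathcomp Require Import ring lra.
Require Import Defs.

Set Implicit Arguments.
Unset Strict Implicit.
Unset Printing Implicit Defensive.

Import Order.TTheory GRing.Theory Num.Theory.
Import numFieldNormedType.Exports.

Local Open Scope classical_set_scope.
Local Open Scope ring_scope.

(* Let phi(m, p) = m^(-1/3) |p|, and write a for the rate.  As phi is
   subadditive, testing the equation against phi only produces loss.  Moreover,
   adding the losses of the pairs (y, y') and (y, -y'), the latter with the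
   momentum of y' reversed, gives
     a(y, y') (phi y + phi y' - phi (y + y')) + the reversed term
       >= phi y * phi y',
   so that, f being even in p, M' <= - M^2 / 4.
   This is made rigorous with the test functions min (phi, n): the weak form is
   extended from smooth products to bounded measurable functions by Dynkin's
   lemma, and n tends to infinity by dominated convergence.  Evenness of f comes
   from uniqueness, reflecting a solution in p giving another one. *)

(** * Measure-preserving maps *)

Section measure_preserving.
Context d (T : measurableType d) (R : realType).
Variable mu : {measure set T -> \bar R}.

Definition measure_preserving (s : T -> T) :=
  measurable_fun setT s /\
  forall A, measurable A -> mu (s @^-1` A) = mu A.

Variables s s' : T -> T.
Hypotheses (ms : measure_preserving s) (ms' : measure_preserving s').
Hypotheses (sK : cancel s s') (s'K : cancel s' s).

Lemma measure_preserving_null A : mu.-negligible A -> mu.-negligible (s @^-1` A).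
Proof.
move=> [B [mB B0 AB]]; exists (s @^-1` B); split.
- by rewrite -[X in measurable X]setTI; exact: ms.1.
- by rewrite ms.2.
- by move=> x /AB.
Qed.

Lemma measure_preserving_ae (P : T -> Prop) :
  {ae mu, forall x, P x} -> {ae mu, forall x, P (s x)}.
Proof. exact: measure_preserving_null. Qed.

End measure_preserving.

Section integral_measure_preserving.
Context d (T : measurableType d) (R : realType).
Variable mu : {measure set T -> \bar R}.
Local Open Scope ereal_scope.

Import HBNNSimple.

Section nnsfun_comp.
Variables (s : T -> T) (ms : measurable_fun setT s) (h : {nnsfun T >-> R}).

Let hs := (h \o s)%R.

Let mhs : measurable_fun setT hs.
Proof. exact: measurableT_comp. Qed.

#[local] HB.instance Definition _ := isMeasurableFun.Build _ _ _ _ hs mhs.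

Let fhs : finite_set (range hs).
Proof.
apply: (sub_finite_set _ (@fimfunP _ _ h)) => _ [x _ <-].
by exists (s x).
Qed.

#[local] HB.instance Definition _ := FiniteImage.Build _ _ hs fhs.

Let hs0 x : (0 <= hs x)%R.
Proof. exact: fun_ge0. Qed.

#[local] HB.instance Definition _ := isNonNegFun.Build _ _ hs hs0.

Definition nnsfun_comp : {nnsfun T >-> R} := hs.

Lemma nnsfun_compE x : nnsfun_comp x = h (s x). Proof. by []. Qed.

Lemma sintegral_comp : (forall A, measurable A -> mu (s @^-1` A) = mu A) ->
  sintegral mu nnsfun_comp = sintegral mu h.
Proof.
move=> mus; rewrite !sintegralET; apply: eq_fsbigr => x _.
by rewrite -(mus (h @^-1` [set x])).
Qed.

End nnsfun_comp.

Lemma ge0_le_integral_comp (s s' : T -> T) (f : T -> \bar R) :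
  measure_preserving mu s' -> cancel s' s ->
  (forall x, 0 <= f x) ->
  \int[mu]_x f (s x) <= \int[mu]_x f x.
Proof.
move=> [ms' mus'] s'K f0.
rewrite !ge0_integralTE//.
apply: ge_ereal_sup => _ [h hf <-].
apply: ereal_sup_ubound; exists (nnsfun_comp ms' h).
  by move=> x; rewrite nnsfun_compE (le_trans (hf _))// s'K.
exact: sintegral_comp.
Qed.

Lemma integral_measure_preserving (s s' : T -> T) (f : T -> \bar R) :
  measure_preserving mu s -> measure_preserving mu s' ->
  cancel s s' -> cancel s' s ->
  \int[mu]_x f (s x) = \int[mu]_x f x.
Proof.
move=> ms ms' sK s'K.
have H (g : T -> \bar R) : (forall x, 0 <= g x) -> \int[mu]_x g (s x) = \int[mu]_x g x.
  move=> g0; apply/eqP; rewrite eq_le (ge0_le_integral_comp ms')//=.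
  have := @ge0_le_integral_comp s' s (g \o s) ms sK (fun=> g0 _).
  by under eq_integral do rewrite /= s'K.
rewrite integralE [RHS]integralE -(H _ (funepos_ge0 f)) -(H _ (funeneg_ge0 f)).
by congr (_ - _); apply: eq_integral => x _; rewrite ?funeposE ?funenegE.
Qed.

End integral_measure_preserving.

Section product_measure_preserving.
Context d1 d2 (T1 : measurableType d1) (T2 : measurableType d2) (R : realType).
Variables (m1 : {sigma_finite_measure set T1 -> \bar R}).
Variables (m2 : {sigma_finite_measure set T2 -> \bar R}).
Local Open Scope ereal_scope.

Lemma measure_preserving_prod (s1 s1' : T1 -> T1) (s2 : T2 -> T2) :
  measure_preserving m1 s1 -> measure_preserving m1 s1' ->
  cancel s1 s1' -> cancel s1' s1 ->
  measure_preserving m2 s2 ->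
  measure_preserving (m1 \x m2) (fun z : T1 * T2 => (s1 z.1, s2 z.2)).
Proof.
move=> ms1 ms1' s1K s1'K [ms2 mus2]; split.
  apply/measurable_fun_pair => /=.
    by apply: measurableT_comp => //; exact: ms1.1.
  exact: measurableT_comp.
move=> A mA; rewrite /= /product_measure1.
rewrite -[RHS](integral_measure_preserving (m2 \o xsection A) ms1 ms1')//=.
apply: eq_integral => x _ /=.
rewrite -[RHS]mus2; last exact: measurable_xsection.
congr (m2 _); apply/seteqP; split => y; rewrite /xsection /= !inE//.
Qed.

End product_measure_preserving.

Section lebesgue_preserving.
Variable R : realType.

Lemma lebesgue_measureD (c : R) (A : set R) : measurable A ->
  lebesgue_measure ((fun x : measurableTypeR R => c + x : measurableTypeR R) @^-1` A)
  = lebesgue_measure A.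
Proof.
move=> mA; apply/esym.
have mc : measurable_fun setT (fun x : measurableTypeR R => c + x : measurableTypeR R).
  exact: measurable_funD.
apply: (@lebesgue_measure_unique R (pushforward lebesgue_measure
  (fun x : measurableTypeR R => c + x : measurableTypeR R))) => //= _ [[a b]] _ <-.
rewrite /pushforward.
rewrite (_ : _ @^-1` _ = `](a - c), (b - c)]%classic); last first.
  by apply/seteqP; split => x; rewrite /= !in_itv/= ltrBlDl lerBrDl.
rewrite !lebesgue_measure_itv/= !lte_fin ltrD2r.
by case: ifP => // _; rewrite -!EFinB; congr EFin; ring.
Qed.

Lemma lebesgue_measure_preserving (c : R) (e : bool) :
  measure_preserving (@lebesgue_measure R)
    (fun x : measurableTypeR R => c + (-1) ^+ e * x : measurableTypeR R).
Proof.
split; first by apply: measurable_funD => //; exact: measurable_funM.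
move=> A mA.
case: e => /=; last first.
  rewrite -[RHS](lebesgue_measureD c mA); congr lebesgue_measure.
  by apply/seteqP; split => x /=; rewrite expr0 mul1r.
rewrite -[RHS](lebesgue_measureD c mA).
rewrite -[RHS]lebesgue_measureN; last first.
  rewrite -[X in measurable X]setTI; apply: (measurable_funD _ _ measurableT mA) => //.
congr lebesgue_measure.
by apply/seteqP; split => x /=; rewrite expr1 mulN1r.
Qed.

Lemma measurable_rV_affine n (c : 'rV[R]_n) (e : bool) :
  measurable_fun setT (fun x : 'rV[R]_n => c + (-1) ^+ e *: x).
Proof.
apply/measurable_fun_rVP => i; under eq_fun do rewrite !mxE.
by apply: measurable_funD => //; apply: measurable_funM => //; exact: measurable_rV_coord.
Qed.

Lemma affine_signK (V : lmodType R) (c : V) (e : bool) :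
  cancel (fun x => c + (-1) ^+ e *: x) (fun x => - ((-1) ^+ e *: c) + (-1) ^+ e *: x).
Proof.
by move=> x; rewrite scalerDr scalerA -expr2 sqrr_sign scale1r addKr.
Qed.

Lemma affine_signK' (V : lmodType R) (c : V) (e : bool) :
  cancel (fun x => - ((-1) ^+ e *: c) + (-1) ^+ e *: x) (fun x => c + (-1) ^+ e *: x).
Proof.
by move=> x; rewrite scalerDr scalerN !scalerA -expr2 sqrr_sign !scale1r addNKr.
Qed.

Lemma lebesgue_rV_preserving n (c : 'rV[R]_n) (e : bool) :
  measure_preserving (lebesgue_rV R n) (fun x => c + (-1) ^+ e *: x).
Proof.
split; first exact: measurable_rV_affine.
elim: n c => [|n IH] c A mA.
  have E : c + (-1) ^+ e *: 0 = 0 :> 'rV[R]_0 by apply/rowP => -[].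
  rewrite /= !diracE; do 3 congr (_ _).
  by apply/idP/idP; rewrite !inE /= E.
rewrite /= /lebesgue_step /pushforward.
have mA' : measurable (@cons_rV R n @^-1` A : set (measurableTypeR R * _)).
  by rewrite -[X in measurable X]setTI; exact: measurable_cons_rV_TypeR.
set c0 := (uncons_rV c).1; set c1 := (uncons_rV c).2.
have [_ /(_ _ mA') /= <-] := @measure_preserving_prod _ _ _ _ R lebesgue_measure (lebesgue_rV R n)
  _ _ _ (lebesgue_measure_preserving c0 e)
  (lebesgue_measure_preserving (- ((-1) ^+ e *: c0)) e)
  (@affine_signK R^o c0 e) (@affine_signK' R^o c0 e)
  (conj (measurable_rV_affine c1 e) (IH c1)).
congr (_ _); apply/funext => -[x p] /=; congr (A _).
apply/rowP => i; rewrite [LHS]mxE [X in _ + X = _]mxE.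
case: (unliftP ord0 i) => [j|] ->.
  by rewrite !cons_rVS /= !mxE.
by rewrite !cons_rV0.
Qed.

End lebesgue_preserving.

Section dy_preserving.
Variables (R : realType) (d : nat).
Local Notation state := (measurableTypeR R * 'rV[R]_d)%type.

Let dy_fun : set state -> \bar R := dy R d.

HB.instance Definition _ := Measure.copy dy_fun (dy R d).

Let dy_sigma_finite : sigma_finite setT dy_fun.
Proof.
have /sigma_finiteP[F [TF ndF Foo]] := sigma_finiteT (@lebesgue_measure R).
have /sigma_finiteP[G [TG ndG Goo]] := sigma_finiteT (lebesgue_rV R d).
exists (fun n => F n `*` G n).
  rewrite -setXTT TF TG predeqE => -[x y]; split.
    move=> [/= [n _ Fnx] [k _ Gky]]; exists (maxn n k) => //; split.
    - by move: x Fnx; exact/subsetPset/ndF/leq_maxl.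
    - by move: y Gky; exact/subsetPset/ndG/leq_maxr.
  by move=> [n _ []/= ? ?]; split; exists n.
move=> k; have [? ?] := Foo k; have [? ?] := Goo k.
split; first exact: measurableX.
by rewrite /dy_fun /dy/= product_measure1E// lte_mul_pinfty// ge0_fin_numE.
Qed.

HB.instance Definition _ := @Measure_isSigmaFinite.Build _ _ _
  dy_fun dy_sigma_finite.

Definition dy_sfinite : {sigma_finite_measure set state -> \bar R} := dy_fun.

Definition reflect_p (y : state) : state := (y.1, - y.2).

Lemma reflect_pK : involutive reflect_p.
Proof. by case=> m p; rewrite /reflect_p /= opprK. Qed.

Let dy_affine (c : state) (e1 e2 : bool) : measure_preserving (dy R d)
  (fun y : state => (c.1 + (-1) ^+ e1 * y.1, c.2 + (-1) ^+ e2 *: y.2)).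
Proof.
exact: (@measure_preserving_prod _ _ _ _ R lebesgue_measure (lebesgue_rV R d)
  _ _ _ (lebesgue_measure_preserving c.1 e1)
  (lebesgue_measure_preserving (- ((-1) ^+ e1 *: (c.1 : R^o))) e1)
  (@affine_signK R R^o c.1 e1) (@affine_signK' R R^o c.1 e1)
  (lebesgue_rV_preserving c.2 e2)).
Qed.

Lemma dy_reflect : measure_preserving (dy R d) reflect_p.
Proof.
have := dy_affine (0, 0) false true; congr measure_preserving.
by apply/funext => y; rewrite /= !add0r expr0 mul1r expr1 scaleN1r.
Qed.

Lemma dy_shift (c : state) : measure_preserving (dy R d) (fun y => c + y).
Proof.
have := dy_affine c false false; congr measure_preserving.
by apply/funext => y; rewrite /= !expr0 mul1r scale1r.
Qed.

End dy_preserving.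

Section enorm.
Variables (R : realType) (d : nat).
Implicit Types p q : 'rV[R]_d.

Definition dot p q : R := \sum_(i < d) p ord0 i * q ord0 i.

Lemma enorm_ge0 p : 0 <= enorm p. Proof. exact: sqrtr_ge0. Qed.

Lemma sqr_enorm p : enorm p ^+ 2 = dot p p.
Proof.
rewrite sqr_sqrtr; last by apply: sumr_ge0 => i _; exact: sqr_ge0.
by apply: eq_bigr => i _; rewrite expr2.
Qed.

Lemma sqr_enormD p q : enorm (p + q) ^+ 2 = enorm p ^+ 2 + enorm q ^+ 2 + 2 * dot p q.
Proof.
rewrite !sqr_enorm /dot mulr_sumr -!big_split/=; apply: eq_bigr => i _.
by rewrite !mxE; ring.
Qed.

Lemma dotZ a b p q : dot (a *: p) (b *: q) = a * b * dot p q.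
Proof. by rewrite /dot mulr_sumr; apply: eq_bigr => i _; rewrite !mxE; ring. Qed.

Lemma enormZ a p : enorm (a *: p) = `|a| * enorm p.
Proof.
apply/eqP; rewrite -(@eqrXn2 _ 2)// ?mulr_ge0 ?enorm_ge0//.
by rewrite exprMn !sqr_enorm dotZ real_normK ?num_real// expr2.
Qed.

Lemma enormN p : enorm (- p) = enorm p.
Proof. by rewrite -scaleN1r enormZ normrN1 mul1r. Qed.

Lemma dot_le p q : dot p q <= enorm p * enorm q.
Proof.
have := enorm_ge0 p; have := enorm_ge0 q.
rewrite [0 <= enorm q]le_eqVlt => /predU1P[q0 p0|q0].
  rewrite -q0 mulr0 /dot big1// => i _.
  suff -> : q ord0 i = 0 by rewrite mulr0.
  have /eqP := sqr_enorm q; rewrite -q0 expr0n/= eq_sym psumr_eq0; last first.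
    by move=> j _; rewrite -expr2 sqr_ge0.
  by move=> /allP/(_ i (mem_index_enum _)); rewrite /= mulf_eq0 orbb => /eqP.
rewrite le_eqVlt => /predU1P[p0|p0].
  rewrite -p0 mul0r /dot big1// => i _.
  suff -> : p ord0 i = 0 by rewrite mul0r.
  have /eqP := sqr_enorm p; rewrite -p0 expr0n/= eq_sym psumr_eq0; last first.
    by move=> j _; rewrite -expr2 sqr_ge0.
  by move=> /allP/(_ i (mem_index_enum _)); rewrite /= mulf_eq0 orbb => /eqP.
have := sqr_ge0 (enorm (enorm q *: p + (- enorm p) *: q)).
rewrite sqr_enormD !enormZ dotZ normrN !ger0_norm ?enorm_ge0// => h.
rewrite -subr_ge0 -(@pmulr_rge0 _ (2 * (enorm p * enorm q))) ?mulr_gt0//.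
by apply: le_trans h _; rewrite le_eqVlt; apply/orP; left; apply/eqP; ring.
Qed.

Lemma ler_enormD p q : enorm (p + q) <= enorm p + enorm q.
Proof.
rewrite -(@ler_pXn2r _ 2)// ?nnegrE ?addr_ge0 ?enorm_ge0//.
rewrite sqr_enormD sqrrD.
have := dot_le p q; lra.
Qed.

Lemma measurable_enorm : measurable_fun [set: 'rV[R]_d] (@enorm R d).
Proof.
have E : @enorm R d = (fun x : R => x `^ (2^-1)) \o (fun p => \sum_(i < d) p ord0 i ^+ 2).
  apply/funext => p; rewrite /= powR12_sqrt//.
  by apply: sumr_ge0 => i _; exact: sqr_ge0.
rewrite E; apply: measurableT_comp; first exact: measurable_powR.
apply: measurable_sum => i; apply: measurable_funX; exact: measurable_rV_coord.
Qed.

End enorm.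

Section pointwise.
Variables (R : realType) (d : nat).
Local Notation state := (measurableTypeR R * 'rV[R]_d)%type.
Implicit Types y z : state.

Definition phi y : R := y.1 `^ (- 3^-1) * enorm y.2.

Lemma phi_ge0 y : 0 <= phi y.
Proof. by rewrite mulr_ge0 ?powR_ge0 ?enorm_ge0. Qed.

Lemma phi_reflect y : phi (reflect_p y) = phi y.
Proof. by rewrite /phi enormN. Qed.

Lemma cbrtK (m : R) : 0 < m -> (m `^ (3^-1)) ^+ 3 = m.
Proof.
move=> m0; rewrite -powR_mulrn ?powR_ge0// -powRrM.
by rewrite mulVf// powRr1// ltW.
Qed.

Lemma phiE y : Y y -> phi y = (y.1 `^ (3^-1))^-1 * enorm y.2.
Proof. by move=> _; rewrite /phi powRN. Qed.

Lemma ler_cbrt (m n : R) : 0 < m -> m <= n -> m `^ (3^-1) <= n `^ (3^-1).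
Proof. by move=> m0 mn; rewrite ge0_ler_powR ?nnegrE// ?ltW// (lt_le_trans m0). Qed.

Lemma YD y z : Y y -> Y z -> Y (y + z).
Proof. by rewrite /Y /= => y0 z0; rewrite addr_gt0. Qed.

Lemma phi_subadditive y z : Y y -> Y z -> phi (y + z) <= phi y + phi z.
Proof.
move=> y0 z0; rewrite !phiE//; last exact: YD.
have a0 : 0 < y.1 `^ 3^-1 by rewrite powR_gt0.
have b0 : 0 < z.1 `^ 3^-1 by rewrite powR_gt0.
have ac : y.1 `^ 3^-1 <= (y + z).1 `^ 3^-1 by rewrite ler_cbrt//= lerDl ltW.
have bc : z.1 `^ 3^-1 <= (y + z).1 `^ 3^-1 by rewrite ler_cbrt//= lerDr ltW.
apply: (le_trans (ler_wpM2l _ (ler_enormD _ _))).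
  by rewrite invr_ge0 powR_ge0.
rewrite mulrDr lerD// ler_wpM2r ?enorm_ge0// lef_pV2// posrE.
  by rewrite (lt_le_trans a0).
by rewrite (lt_le_trans a0).
Qed.

Lemma aHS_ge0 y z : 0 <= aHS y z.
Proof. by rewrite mulr_ge0 ?enorm_ge0// exprn_ge0// addr_ge0 ?powR_ge0. Qed.

Lemma aHS_sym y z : aHS y z = aHS z y.
Proof. by rewrite /aHS addrC -opprB enormN. Qed.

Lemma aHS_reflect y z : aHS (reflect_p y) (reflect_p z) = aHS y z.
Proof. by rewrite /aHS /velocity /= !scalerN -opprD enormN. Qed.

Lemma kS_reflect y : kS (reflect_p y) = kS y.
Proof. by rewrite /kS /velocity /= scalerN !enormN. Qed.

Lemma kS_ge1 y : Y y -> 1 <= kS y.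
Proof.
move=> /ltW y0; rewrite /kS -!addrA lerDl; apply: addr_ge0 => //.
by rewrite addr_ge0 ?enorm_ge0.
Qed.

Let velocity_norm y : Y y -> enorm (velocity y) = enorm y.2 / y.1.
Proof. by move=> y0; rewrite enormZ ger0_norm ?invr_ge0 ?ltW// mulrC. Qed.

Lemma phi_le_kS y : Y y -> phi y <= kS y.
Proof.
move=> y0; rewrite phiE//.
apply: (@le_trans _ _ (enorm y.2 + enorm (velocity y))); last first.
  rewrite /kS -addrA lerDr addr_ge0// ltW//.
rewrite velocity_norm//.
have := cbrtK y0; set a := _ `^ _ => aE.
have a0 : 0 < a by rewrite powR_gt0.
have p0 := enorm_ge0 y.2.
have [a1|a1] := leP 1 a.
  rewrite -[X in X <= _]addr0 lerD ?divr_ge0 ?(ltW y0)//.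
  by rewrite ler_piMl// invf_le1.
rewrite -[X in X <= _]add0r lerD// mulrC ler_wpM2l// lef_pV2 ?posrE//.
by rewrite -aE exprS ger_pMr// exprn_ile1 ?ltW.
Qed.

Lemma aHS_le y z : Y y -> Y z -> aHS y z <= 8 * (kS y * kS z).
Proof.
move=> y0 z0.
have k1 := kS_ge1 y0; have k2 := kS_ge1 z0.
have cb (m : R) : 0 < m -> (m `^ 3^-1) ^+ 2 <= 1 + m.
  move=> m0; have := cbrtK m0; set a := _ `^ _ => <-.
  have a0 : 0 <= a by exact: powR_ge0.
  have [a1|a1] := leP 1 a.
    by rewrite (@le_trans _ _ (a ^+ 3))// ?lerDr ?ler01// ler_weXn2l.
  by rewrite (@le_trans _ _ 1)// ?exprn_ile1 ?(ltW a1)// lerDl exprn_ge0.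
have h1 : (y.1 `^ 3^-1 + z.1 `^ 3^-1) ^+ 2 <= 2 * ((1 + y.1) + (1 + z.1)).
  have := cb _ y0; have := cb _ z0.
  have := sqr_ge0 (y.1 `^ 3^-1 - z.1 `^ 3^-1); rewrite sqrrB sqrrD; lra.
have h2 : enorm (velocity y - velocity z) <= enorm (velocity y) + enorm (velocity z).
  by rewrite (le_trans (ler_enormD _ _))// enormN.
apply: (le_trans (ler_pM _ _ h1 h2)) => //; rewrite ?enorm_ge0 ?sqr_ge0//.
have mv (x : state) : Y x -> (1 + x.1) * enorm (velocity x) <= kS x.
  move=> x0; rewrite mulrDl mul1r velocity_norm// [x.1 * _]mulrC divfK ?gt_eqF//.
  by rewrite /kS velocity_norm// addrC lerD2r lerDr addr_ge0// ltW.
have m1 (x : state) : Y x -> 1 + x.1 <= kS x.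
  by move=> x0; rewrite /kS -addrA lerDl addr_ge0 ?enorm_ge0.
have v1 (x : state) : Y x -> enorm (velocity x) <= kS x.
  by move=> x0; rewrite /kS lerDr !addr_ge0 ?enorm_ge0// ltW.
have := mv _ y0; have := mv _ z0.
have e1 : (1 + y.1) * enorm (velocity z) <= kS y * kS z.
  by rewrite ler_pM ?enorm_ge0 ?m1 ?v1// addr_ge0// ltW.
have e2 : (1 + z.1) * enorm (velocity y) <= kS y * kS z.
  by rewrite mulrC ler_pM ?enorm_ge0 ?m1 ?v1// addr_ge0// ltW.
have e3 : kS y <= kS y * kS z by rewrite ler_peMr// (le_trans _ k1).
have e4 : kS z <= kS y * kS z by rewrite ler_peMl// (le_trans _ k2).
move=> e5 e6.
rewrite -mulrA [X in 2 * X]mulrDl [(1 + y.1) * _]mulrDr [(1 + z.1) * _]mulrDr.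
move: e1 e2 e3 e4 e5 e6.
move: (kS y * kS z) ((1 + y.1) * _) ((1 + y.1) * _) ((1 + z.1) * _) ((1 + z.1) * _) => *.
lra.
Qed.

(* Only the half of the pair for which the momenta point away from each other
   is used; [X] stands for |v - v'| and [N] for |p + p'|. *)
Let key_scalar (a b c P P' X N : R) : 0 < a -> 0 < b -> a <= c -> b <= c ->
  0 <= P -> 0 <= P' -> 0 <= X -> 0 <= N ->
  (P / a ^+ 3) ^+ 2 + (P' / b ^+ 3) ^+ 2 <= X ^+ 2 ->
  N ^+ 2 <= P ^+ 2 + P' ^+ 2 ->
  (a^-1 * P) * (b^-1 * P') <= (a + b) ^+ 2 * X * (a^-1 * P + b^-1 * P' - c^-1 * N).
Proof.
move=> a0 b0 ac bc P0 P'0 X0 N0 hX hN.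
have c0 : 0 < c by exact: lt_le_trans ac.
set f := a^-1 * P; set g := b^-1 * P'; set n := c^-1 * N.
have f0 : 0 <= f by rewrite mulr_ge0 ?invr_ge0 ?(ltW a0).
have g0 : 0 <= g by rewrite mulr_ge0 ?invr_ge0 ?(ltW b0).
have n0 : 0 <= n by rewrite mulr_ge0 ?invr_ge0 ?(ltW c0).
have hn : n ^+ 2 <= f ^+ 2 + g ^+ 2.
  apply: (@le_trans _ _ (c^-1 ^+ 2 * (P ^+ 2 + P' ^+ 2))).
    by rewrite exprMn ler_wpM2l ?sqr_ge0.
  by rewrite mulrDr !exprMn lerD// ler_wpM2r ?sqr_ge0// ler_pXn2r ?nnegrE ?invr_ge0 ?(ltW a0) ?(ltW b0) ?(ltW c0)// lef_pV2 ?posrE.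
have nfg : n <= f + g.
  rewrite -(@ler_pXn2r _ 2)// ?nnegrE ?addr_ge0//; apply: (le_trans hn).
  by rewrite sqrrD addrAC lerDl mulrn_wge0// mulr_ge0.
have V1 : P / a ^+ 3 <= X.
  rewrite -(@ler_pXn2r _ 2)// ?nnegrE ?divr_ge0 ?exprn_ge0 ?(ltW a0) ?(ltW b0)//.
  by apply: le_trans hX; rewrite lerDl sqr_ge0.
have V2 : P' / b ^+ 3 <= X.
  rewrite -(@ler_pXn2r _ 2)// ?nnegrE ?divr_ge0 ?exprn_ge0 ?(ltW a0) ?(ltW b0)//.
  by apply: le_trans hX; rewrite lerDr sqr_ge0.
have fX : f <= a ^+ 2 * X.
  have -> : f = a ^+ 2 * (P / a ^+ 3) by rewrite /f; field; rewrite gt_eqF.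
  by rewrite ler_wpM2l ?sqr_ge0.
have gX : g <= b ^+ 2 * X.
  have -> : g = b ^+ 2 * (P' / b ^+ 3) by rewrite /g; field; rewrite gt_eqF.
  by rewrite ler_wpM2l ?sqr_ge0.
have sX : f + g <= (a + b) ^+ 2 * X.
  have : 0 <= a * b * X by rewrite !mulr_ge0 ?(ltW a0) ?(ltW b0).
  have -> : (a + b) ^+ 2 * X = a ^+ 2 * X + b ^+ 2 * X + 2 * (a * b * X) by ring.
  lra.
apply: (@le_trans _ _ ((f + g) * (f + g - n))); last first.
  by rewrite ler_wpM2r// subr_ge0.
have := sqr_ge0 (f + g - n); nra.
Qed.

Lemma key_inequality y z : Y y -> Y z ->
  phi y * phi z <= aHS y z * (phi y + phi z - phi (y + z)) +
    aHS y (reflect_p z) * (phi y + phi z - phi (y + reflect_p z)).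
Proof.
move=> y0 z0; have rz0 : Y (reflect_p z) by [].
have s1 : 0 <= phi y + phi z - phi (y + z) by rewrite subr_ge0 phi_subadditive.
have s2 : 0 <= phi y + phi z - phi (y + reflect_p z).
  by rewrite subr_ge0 -(phi_reflect z) phi_subadditive.
have a0 : 0 < y.1 `^ 3^-1 by rewrite powR_gt0.
have b0 : 0 < z.1 `^ 3^-1 by rewrite powR_gt0.
have ac : y.1 `^ 3^-1 <= (y + z).1 `^ 3^-1 by rewrite ler_cbrt//= lerDl ltW.
have bc : z.1 `^ 3^-1 <= (y + z).1 `^ 3^-1 by rewrite ler_cbrt//= lerDr ltW.
have V1 : enorm (velocity y) = enorm y.2 / (y.1 `^ 3^-1) ^+ 3.
  by rewrite cbrtK// velocity_norm.
have V2 : enorm (velocity z) = enorm z.2 / (z.1 `^ 3^-1) ^+ 3.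
  by rewrite cbrtK// velocity_norm.
have dV : dot (velocity y) (velocity z) = (y.1^-1 * z.1^-1) * dot y.2 z.2.
  by rewrite dotZ.
have i0 : 0 <= y.1^-1 * z.1^-1 by rewrite mulr_ge0// invr_ge0 ltW.
have dN (p q : 'rV[R]_d) : dot p (- q) = - dot p q.
  by rewrite -[p]scale1r -scaleN1r dotZ mul1r mulN1r scale1r.
have [c0|c0] := leP (dot y.2 z.2) 0.
  apply: (@le_trans _ _ (aHS y z * (phi y + phi z - phi (y + z)))); last first.
    by rewrite lerDl mulr_ge0// aHS_ge0.
  rewrite !phiE//; last exact: YD.
  apply: key_scalar; rewrite ?enorm_ge0//.
    rewrite -V1 -V2 sqr_enormD enormN dN lerDl.
    by rewrite mulrN oppr_ge0 pmulr_rle0// dV mulr_ge0_le0.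
  by rewrite sqr_enormD gerDl pmulr_rle0.
apply: (@le_trans _ _ (aHS y (reflect_p z) * (phi y + phi z - phi (y + reflect_p z)))); last first.
  by rewrite lerDr mulr_ge0// aHS_ge0.
rewrite !phiE//; last exact: YD.
apply: key_scalar; rewrite ?enorm_ge0//.
  rewrite -V1 -V2 [velocity (reflect_p z)]scalerN opprK sqr_enormD lerDl.
  by rewrite pmulr_rge0// dV mulr_ge0// ltW.
by rewrite sqr_enormD /= enormN dN gerDl mulrN oppr_le0 pmulr_rge0// ltW.
Qed.

Lemma measurable_invr : measurable_fun [set: R] (fun x : R => x^-1).
Proof.
have -> : (fun x : R => x^-1) = (fun x => x * (x ^+ 2) `^ (-1)).
  apply/funext => x; rewrite powR_inv1 ?sqr_ge0//.
  have [->|x0] := eqVneq x 0; first by rewrite invr0 mul0r.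
  by rewrite expr2 invfM mulrA divff// mul1r.
apply: measurable_funM => //.
by apply: (measurableT_comp (@measurable_powR R _)); exact: measurable_funX.
Qed.

Lemma measurable_velocity : measurable_fun [set: state] (fun y : state => velocity y).
Proof.
apply/measurable_fun_rVP => i; rewrite /velocity; under eq_fun do rewrite mxE.
apply: measurable_funM; first exact: (measurableT_comp measurable_invr).
exact: (measurableT_comp (@measurable_rV_coord _ _ d i)).
Qed.

Lemma measurable_phi : measurable_fun [set: state] phi.
Proof.
apply: measurable_funM.
  by apply: (measurableT_comp (@measurable_powR R _)).
exact: measurableT_comp (@measurable_enorm R d) _.
Qed.

Lemma measurable_kS : measurable_fun [set: state] (fun y : state => kS y).
Proof.
apply: measurable_funD; last first.
  exact: measurableT_comp (@measurable_enorm R d) measurable_velocity.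
apply: measurable_funD; last exact: measurableT_comp (@measurable_enorm R d) _.
exact: measurable_funD.
Qed.

Lemma measurable_aHS :
  measurable_fun [set: state * state] (fun z : state * state => aHS z.1 z.2).
Proof.
apply: measurable_funM.
  apply: measurable_funX; apply: measurable_funD.
    by apply: (measurableT_comp (@measurable_powR R _)); exact: measurableT_comp.
  by apply: (measurableT_comp (@measurable_powR R _)); exact: measurableT_comp.
apply: (measurableT_comp (@measurable_enorm R d)).
apply/measurable_fun_rVP => i.
have mv := (measurable_fun_rVP _).1 measurable_velocity i.
rewrite [X in measurable_fun _ X](_ : _ =
    (fun z : state * state => velocity z.1 ord0 i - velocity z.2 ord0 i)); last first.
  by apply/funext => z; rewrite [LHS]mxE [X in _ + X]mxE.
apply: measurable_funB.
  exact: (measurableT_comp mv measurable_fst).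
exact: (measurableT_comp mv measurable_snd).
Qed.

Lemma measurable_Y : measurable (@Y R d : set state).
Proof.
rewrite (_ : @Y R d = (fst : state -> measurableTypeR R) @^-1` `]0, +oo[%classic).
  by rewrite -[X in measurable X]setTI; exact: measurable_fst.
by apply/seteqP; split => y; rewrite /Y /= in_itv/= andbT.
Qed.

Lemma measurable_addS :
  measurable_fun [set: state * state] (fun z : state * state => (z.1 + z.2 : state)).
Proof.
apply/measurable_fun_pair => /=.
  by apply: measurable_funD; apply: measurableT_comp.
apply/measurable_fun_rVP => i; under eq_fun do rewrite !mxE.
apply: measurable_funD.
  exact: (measurableT_comp (@measurable_rV_coord _ _ d i) (measurableT_comp measurable_snd measurable_fst)).
exact: (measurableT_comp (@measurable_rV_coord _ _ d i) (measurableT_comp measurable_snd measurable_snd)).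
Qed.

Lemma measurable_subS :
  measurable_fun [set: state * state] (fun z : state * state => (z.1 - z.2 : state)).
Proof.
apply/measurable_fun_pair => /=.
  by apply: measurable_funB; apply: measurableT_comp.
apply/measurable_fun_rVP => i; under eq_fun do rewrite !mxE.
apply: measurable_funB.
  exact: (measurableT_comp (@measurable_rV_coord _ _ d i) (measurableT_comp measurable_snd measurable_fst)).
exact: (measurableT_comp (@measurable_rV_coord _ _ d i) (measurableT_comp measurable_snd measurable_snd)).
Qed.

End pointwise.

(** * Smooth compactly supported functions *)

Section flat.
Variable R : realType.
Implicit Types (f g : R -> R) (x : R) (n : nat).

Definition flat_exp n x : R := if 0 < x then x^-1 ^+ n * expR (- x^-1) else 0.

Lemma flat_exp_ge0 n x : 0 <= flat_exp n x.
Proof.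
rewrite /flat_exp; case: ifPn => // x0.
by rewrite mulr_ge0 ?expR_ge0// exprn_ge0// invr_ge0 ltW.
Qed.

Lemma flat_exp_le n x : flat_exp n x <= n`!%:R.
Proof.
rewrite /flat_exp; case: ifPn => // x0.
case: n => [|n]; first by rewrite expr0 mul1r fact0 expR_le1 oppr_le0 invr_ge0 ltW.
have u0 : 0 <= x^-1 by rewrite invr_ge0 ltW.
rewrite expRN ler_pdivrMr ?expR_gt0// -ler_pdivrMl ?ltr0n ?fact_gt0// mulrC.
by apply: le_trans (expR_ge1Dxn n u0); rewrite lerDr.
Qed.

Let flat_exp_derive_pos n x : 0 < x ->
  is_derive x 1 (fun y : R => y^-1 ^+ n * expR (- y^-1)) (- n%:R * flat_exp n.+1 x + flat_exp n.+2 x).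
Proof.
move=> x0.
have x0' : x != 0 by rewrite gt_eqF.
pose K (u : R) : R := u ^+ n * expR (- u).
have dK (u : R) : is_derive u 1 K (n%:R * u ^+ n.-1 * expR (- u) - u ^+ n * expR (- u)).
  have d1 : is_derive u 1 (fun u : R => u ^+ n) (n%:R * u ^+ n.-1).
    by apply: DeriveDef; [exact: exprn_derivable|rewrite exp_derive /GRing.scale/= mulr1 mulr_natl].
  have d2 : is_derive u 1 (fun u : R => expR (- u)) (- expR (- u)).
    have := @is_derive1_comp _ expR -%R u _ _ (is_derive_expR _) (is_deriveNid u 1).
    by rewrite mulrN1.
  apply: is_derive_eq (is_deriveM d1 d2) _.
  by rewrite /GRing.scale/=; ring.
have dV : is_derive x 1 (fun y : R => y^-1) (- x^-1 ^+ 2).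
  apply: DeriveDef; first exact: derivableV.
  by rewrite deriveV// derive_id /GRing.scale/= mulr1 exprVn.
have := @is_derive1_comp _ K (fun y : R => y^-1) x _ _ (dK _) dV.
move/is_derive_eq; apply.
rewrite /flat_exp x0 /=; case: n {K dK dV} => [|n]; rewrite /= ?exprS ?expr0; ring.
Qed.

Lemma is_derive_flat_exp n x : is_derive x 1 (flat_exp n) (- n%:R * flat_exp n.+1 x + flat_exp n.+2 x).
Proof.
have [x0|x0|->] := ltgtP x 0.
- have F0 k : flat_exp k x = 0 by rewrite /flat_exp ltNge (ltW x0).
  rewrite !F0 mulr0 addr0.
  apply: (@near_eq_is_derive _ _ _ (cst 0)).
  near=> y; rewrite /cst /flat_exp ltNge ifF//; apply/negbTE; rewrite negbK.
  by apply: ltW; near: y; exact: lt_nbhsl.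
- apply: near_eq_is_derive (flat_exp_derive_pos n x0).
  near=> y; rewrite /flat_exp ifT//.
  by near: y; exact: lt_nbhsr.
rewrite /flat_exp ltxx mulr0 addr0 -/(flat_exp n).
have F0 : (fun h : R => h^-1 *: ((flat_exp n \o shift 0) (h *: 1) - flat_exp n 0)) @ 0^' --> (0 : R).
  pose C : R := (n.+2)`!%:R.
  have H (h : R) : `|h^-1 *: ((flat_exp n \o shift 0) (h *: 1) - flat_exp n 0)| <= C * `|h|.
    rewrite /= /GRing.scale/= mulr1 addr0 {2}/flat_exp ltxx subr0.
    have [h0|h0] := ltP 0 h; last first.
      by rewrite /flat_exp ltNge h0/= mulr0 normr0 mulr_ge0// ler0n.
    rewrite gtr0_norm ?h0 ?mulr_gt0 ?invr_gt0//; last first.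
      by rewrite /flat_exp h0 mulr_gt0 ?expR_gt0// exprn_gt0// invr_gt0.
    have := flat_exp_le n.+2 h; rewrite /flat_exp h0 (gtr0_norm h0) => H.
    rewrite -ler_pdivrMr//; apply: le_trans H.
    by rewrite le_eqVlt; apply/orP; left; apply/eqP; rewrite !exprS; ring.
  apply/cvgr0Pnorm_le => e e0; near=> h.
  apply: (le_trans (H h)).
  rewrite -ler_pdivlMl ?ltr0n ?fact_gt0//.
  near: h; apply: dnbhs0_le.
  by rewrite mulr_gt0// invr_gt0 ltr0n fact_gt0.
apply: DeriveDef; first by apply/cvg_ex; exists 0.
exact/cvg_lim.
Unshelve. all: by end_near. Qed.

Inductive flat : (R -> R) -> Prop :=
| flat_base n : flat (flat_exp n)
| flatD f g : flat f -> flat g -> flat (fun x => f x + g x)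
| flatZ c f : flat f -> flat (fun x => c * f x).

Lemma flat_derive f : flat f -> (forall x, derivable f x 1) /\ flat (derive1 f).
Proof.
elim=> [n|{}f g _ [df ff] _ [dg fg]|c {}f _ [df ff]].
- split; first by move=> x; exact: (@ex_derive _ _ _ _ _ _ _ (is_derive_flat_exp n x)).
  rewrite (_ : derive1 _ = fun x => - n%:R * flat_exp n.+1 x + flat_exp n.+2 x).
    by apply: flatD; [apply: flatZ|]; exact: flat_base.
  by apply/funext => x; rewrite derive1E (@derive_val _ _ _ _ _ _ _ (is_derive_flat_exp n x)).
- split; first by move=> x; exact: derivableD.
  rewrite (_ : derive1 _ = fun x => derive1 f x + derive1 g x); first exact: flatD.
  by apply/funext => x; rewrite !derive1E deriveD.
- split; first by move=> x; exact: derivableZ.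
  rewrite (_ : derive1 _ = fun x => c * derive1 f x); first exact: flatZ.
  by apply/funext => x; rewrite !derive1E deriveZ.
Qed.

Definition smooth1 f := forall n x, derivable (derive1n n f) x 1.

Lemma flat_smooth1 f : flat f -> smooth1 f.
Proof.
move=> ff n; apply: (flat_derive _).1.
by elim: n => [//|n IH]; rewrite derive1nS; exact: (flat_derive IH).2.
Qed.

Lemma smooth1_derive f : smooth1 f -> smooth1 (derive1 f).
Proof. by move=> sf n x; rewrite -derive1Sn; exact: sf. Qed.

Lemma smooth1_primitive f : (forall x, derivable f x 1) -> smooth1 (derive1 f) -> smooth1 f.
Proof. by move=> df sf [|n] x; [exact: df|rewrite derive1Sn; exact: sf]. Qed.

End flat.

Section smooth_functions.
Variables (R : realType) (V : normedModType R).
Implicit Types f g : V -> R.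

(* Unlike the class of all smooth functions, this one is closed under
   directional derivatives by construction. *)
Inductive smooth_class : (V -> R) -> Prop :=
| smooth_class_cst c : smooth_class (fun=> c)
| smooth_class_comp (g : R -> R) (l : V -> R) (dl : V -> R) : smooth1 g ->
    (forall x, differentiable l x) -> (forall x v, 'D_v l x = dl v) ->
    smooth_class (fun x => g (l x))
| smooth_classD f g : smooth_class f -> smooth_class g -> smooth_class (fun x => f x + g x)
| smooth_classM f g : smooth_class f -> smooth_class g -> smooth_class (fun x => f x * g x).

Lemma smooth_class_differentiable f : smooth_class f -> forall x, differentiable f x.
Proof.
elim=> [c x|g l dl sg dfl _ x|{}f g _ df _ dg x|{}f g _ df _ dg x].
- exact: differentiable_cst.
- apply: (@differentiable_comp _ _ _ _ l g) => //.
  by apply/derivable1_diffP; exact: (sg 0%N).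
- exact: differentiableD.
- exact: differentiableM.
Qed.

Lemma smooth_class_derive f v : smooth_class f -> smooth_class ('D_v f).
Proof.
elim=> [c|g l dl sg dfl Dl|{}f g sf IHf sg IHg|{}f g sf IHf sg IHg].
- rewrite (_ : 'D_v _ = fun=> 0); first exact: smooth_class_cst.
  by apply/funext => x; rewrite derive_cst.
- rewrite (_ : 'D_v _ = fun x => dl v * derive1 g (l x)).
    apply: smooth_classM; first exact: smooth_class_cst.
    exact: (smooth_class_comp (smooth1_derive sg) dfl Dl).
  apply/funext => x.
  have dg : differentiable g (l x) by apply/derivable1_diffP; exact: (sg 0%N).
  rewrite deriveE; last exact: differentiable_comp.
  by rewrite (@diff_comp _ _ _ _ l g)//= diff1E//= -deriveE// Dl.
- rewrite (_ : 'D_v _ = fun x => 'D_v f x + 'D_v g x); first exact: smooth_classD.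
  by apply/funext => x; rewrite deriveD//; apply: diff_derivable; exact: smooth_class_differentiable.
- rewrite (_ : 'D_v _ = fun x => f x * 'D_v g x + g x * 'D_v f x).
    by apply: smooth_classD; apply: smooth_classM.
  by apply/funext => x; rewrite deriveM//; apply: diff_derivable; exact: smooth_class_differentiable.
Qed.

Lemma smooth_class_iter_derive vs f : smooth_class f -> smooth_class (iter_derive vs f).
Proof. by elim: vs f => //= v vs IH f sf; apply: IH; exact: smooth_class_derive. Qed.

Lemma smooth_class_smooth f : smooth_class f -> smooth f.
Proof.
move=> sf vs; have sf' := smooth_class_iter_derive vs sf; split => x.
  exact/differentiable_continuous/smooth_class_differentiable.
by move=> v; apply: diff_derivable; exact: smooth_class_differentiable.
Qed.

Lemma smooth_class_prod n (f : 'I_n -> V -> R) : (forall i, smooth_class (f i)) ->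
  smooth_class (fun x => \prod_(i < n) f i x).
Proof.
elim: n f => [|n IH] f sf.
  by rewrite (_ : (fun x => _) = fun=> 1); [exact: smooth_class_cst|apply/funext => x; rewrite big_ord0].
rewrite (_ : (fun x => _) = fun x => f ord0 x * \prod_(i < n) f (lift ord0 i) x).
  by apply: smooth_classM => //; apply: IH.
by apply/funext => x; rewrite big_ord_recl.
Qed.

End smooth_functions.

Lemma smooth_class_smooth1 (R : realType) (f : R -> R) : smooth_class (f : R^o -> R) -> smooth1 f.
Proof.
move=> sf n x; apply: diff_derivable; apply: smooth_class_differentiable.
elim: n => [//|n IH]; rewrite derive1nS.
rewrite (_ : derive1 _ = 'D_1 (derive1n n f)); first exact: smooth_class_derive.
by apply/funext => y; rewrite derive1E.
Qed.

Section bump.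
Variable R : realType.

Lemma smooth_class_scale (V : normedModType R) (l : V -> R) (dl : V -> R) (g : R -> R) (k a : R) :
  smooth1 g -> (forall x, differentiable l x) -> (forall x v, 'D_v l x = dl v) ->
  smooth_class (fun x => g (k * (l x - a))).
Proof.
move=> sg dfl Dl.
apply: (@smooth_class_comp _ _ _ _ (fun v => k * dl v) sg).
  by move=> x; apply: differentiableM => //; exact: differentiableB.
move=> x v; have dlx : derivable l x v by exact: diff_derivable.
have -> : (fun x : V => k * (l x - a)) = k *: (l \- cst a) by [].
by rewrite deriveZ ?deriveB ?derive_cst ?subr0 ?Dl//; exact: derivableB.
Qed.

Definition bump (a b k x : R) : R := flat_exp 0 (k * (x - a)) * flat_exp 0 (- k * (x - b)).

Lemma smooth_class_bump (V : normedModType R) (l dl : V -> R) (a b k : R) :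
  (forall x, differentiable l x) -> (forall x v, 'D_v l x = dl v) ->
  smooth_class (fun x => bump a b k (l x)).
Proof.
move=> dfl Dl; apply: smooth_classM;
by apply: (smooth_class_scale _ _ _ dfl Dl); apply: flat_smooth1; exact: flat_base.
Qed.

Lemma smooth1_bump (a b k : R) : smooth1 (bump a b k).
Proof.
apply: smooth_class_smooth1; apply: (@smooth_class_bump R^o id id) => //.
by move=> x v; rewrite derive_id.
Qed.

Lemma bump_ge0 a b k x : 0 <= bump a b k x.
Proof. by rewrite mulr_ge0 ?flat_exp_ge0. Qed.

Lemma bump_le1 a b k x : bump a b k x <= 1.
Proof. by rewrite -(mulr1 1) ler_pM ?flat_exp_ge0//; exact: (@flat_exp_le _ 0). Qed.

Lemma bump_gt0 a b k x : 0 < k -> a < x < b -> 0 < bump a b k x.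
Proof.
move=> k0 /andP[ax xb].
have H (c : R) : 0 < c -> 0 < flat_exp 0 c by move=> c0; rewrite /flat_exp c0 expr0 mul1r expR_gt0.
rewrite mulr_gt0// H//; first by rewrite mulr_gt0// subr_gt0.
by rewrite mulNr -mulrN mulr_gt0// opprB subr_gt0.
Qed.

Lemma bump_out a b k x : 0 < k -> ~~ (a < x < b) -> bump a b k x = 0.
Proof.
have H (c : R) : c <= 0 -> flat_exp 0 c = 0 by rewrite /flat_exp ltNge => ->.
move=> k0; rewrite negb_and -!leNgt /bump => /orP[xa|bx].
  by rewrite H ?mul0r// pmulr_rle0// subr_le0.
by rewrite [X in _ * X]H ?mulr0// mulNr -mulrN pmulr_rle0// opprB subr_le0.
Qed.

Lemma bump_cvg a b x :
  bump a b k.+1%:R x @[k --> \oo] --> (\1_`]a, b[ x : R).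
Proof.
rewrite indicE mem_setE in_itv/=; have [axb|axb] := boolP (a < x < b); last first.
  by under eq_fun do rewrite bump_out ?ltr0n//; exact: cvg_cst.
have H (c : R) : 0 < c -> flat_exp 0 (k.+1%:R * c) @[k --> \oo] --> (1 : R).
  move=> c0.
  under eq_fun do rewrite /flat_exp mulr_gt0 ?ltr0n// expr0 mul1r.
  have h0 : - (k.+1%:R * c)^-1 @[k --> \oo] --> (0 : R).
    under eq_fun do rewrite invfM mulrC -mulNr.
    have := cvgMl_tmp (a := - c^-1) (@cvg_harmonic R).
    by rewrite mulr0; apply.
  have := @cvg_comp _ _ _ _ expR _ _ _ h0 (@continuous_expR R 0).
  by rewrite expR0; apply.
have /andP[ax xb] := axb.
have h1 : flat_exp 0 (k.+1%:R * (x - a)) @[k --> \oo] --> (1 : R) by apply: H; rewrite subr_gt0.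
have h2 : flat_exp 0 (- k.+1%:R * (x - b)) @[k --> \oo] --> (1 : R).
  under eq_fun do rewrite mulNr -mulrN opprB.
  by apply: H; rewrite subr_gt0.
by have := cvgM h1 h2; rewrite mulr1; apply.
Qed.

End bump.

Section box_bump.
Variables (R : realType) (d : nat).
Local Notation state := (R * 'rV[R]_d)%type.
Implicit Types (a b : R * 'rV[R]_d) (y : state).

Definition box_bump a b (k : R) y : R :=
  bump a.1 b.1 k y.1 * \prod_(i < d) bump (a.2 ord0 i) (b.2 ord0 i) k (y.2 ord0 i).

Definition open_box a b : set state :=
  [set y : state | a.1 < y.1 < b.1 /\ forall i, a.2 ord0 i < y.2 ord0 i < b.2 ord0 i].

Lemma box_bump_ge0 a b k y : 0 <= box_bump a b k y.
Proof. by rewrite mulr_ge0 ?bump_ge0// prodr_ge0// => i _; exact: bump_ge0. Qed.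

Lemma box_bump_le1 a b k y : box_bump a b k y <= 1.
Proof.
rewrite -(mulr1 1) ler_pM ?bump_ge0 ?bump_le1//.
  by rewrite prodr_ge0// => i _; exact: bump_ge0.
by apply: prodr_ile1 => i _; rewrite bump_ge0 bump_le1.
Qed.

Lemma box_bump_cvg a b y :
  box_bump a b k.+1%:R y @[k --> \oo] --> (\1_(open_box a b) y : R).
Proof.
have -> : \1_(open_box a b) y = \1_`]a.1, b.1[ y.1 *
    \prod_(i < d) \1_`]a.2 ord0 i, b.2 ord0 i[ (y.2 ord0 i) :> R.
  rewrite !indicE; have [y1|y1] := boolP (y.1 \in `]a.1, b.1[%classic); last first.
    rewrite mul0r memNset// => -[y1' _]; move: y1; rewrite notin_setE /= in_itv/=.
    exact.
  rewrite mul1r; move: y1; rewrite inE/= in_itv/= => y1.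
  have [h|h] := boolP (y \in open_box a b).
    rewrite big1// => i _; rewrite indicE mem_set//= in_itv/=.
    by move: h; rewrite inE => -[].
  have : exists i, ~ (a.2 ord0 i < y.2 ord0 i < b.2 ord0 i).
    apply/existsNP => H; move: h; rewrite notin_setE => /=; apply; split => //.
  move=> [i Hi]; rewrite (bigD1 i)//= indicE memNset ?mul0r//=.
apply: cvgM; first exact: bump_cvg.
elim: (index_enum 'I_d) => [|i r IH].
  by under eq_fun do rewrite big_nil; rewrite big_nil; exact: cvg_cst.
under eq_fun do rewrite big_cons; rewrite big_cons.
by apply: cvgM => //; exact: bump_cvg.
Qed.

Lemma measurable_bump (k s t : R) : measurable_fun setT (bump s t k).
Proof.
apply: continuous_measurable_fun => x.
apply: differentiable_continuous; apply/derivable1_diffP.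
exact: (@smooth1_bump _ _ _ _ 0%N).
Qed.

Lemma measurable_box_bump a b k :
  measurable_fun [set: measurableTypeR R * 'rV[R]_d] (box_bump a b k).
Proof.
apply: measurable_funM; first exact: (measurableT_comp (measurable_bump _ _ _)).
apply: measurable_prod => i _.
apply: (measurableT_comp (measurable_bump _ _ _)).
exact: (measurableT_comp (@measurable_rV_coord _ _ d i)).
Qed.

Local Notation V := (R * state)%type.

Lemma linear_affine (l : {linear V -> R}) : continuous l ->
  (forall x, differentiable l x) /\ (forall x v, 'D_v l x = l v).
Proof.
move=> cl; have dl x : differentiable l x by exact: linear_differentiable.
by split => // x v; rewrite deriveE// diff_lin.
Qed.

Definition time_coord (x : V) : R := x.1.
Definition mass_coord (x : V) : R := x.2.1.
Definition momentum_coord i (x : V) : R := x.2.2 ord0 i.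

Let time_coord_linear : linear time_coord. Proof. by []. Qed.
HB.instance Definition _ := GRing.isLinear.Build R V R _ time_coord time_coord_linear.
Let mass_coord_linear : linear mass_coord. Proof. by []. Qed.
HB.instance Definition _ := GRing.isLinear.Build R V R _ mass_coord mass_coord_linear.
Let momentum_coord_linear i : linear (momentum_coord i).
Proof. by move=> c x y; rewrite /momentum_coord /= !mxE. Qed.
HB.instance Definition _ i := GRing.isLinear.Build R V R _ (momentum_coord i)
  (momentum_coord_linear i).

Let time_coord_continuous : continuous time_coord.
Proof. by move=> x; exact: cvg_fst. Qed.

Let mass_coord_continuous : continuous mass_coord.
Proof.
by move=> x; apply: (@continuous_comp _ _ _ snd fst); [exact: cvg_snd|exact: cvg_fst].
Qed.

Let momentum_coord_continuous i : continuous (momentum_coord i).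
Proof.
move=> x; apply: (@continuous_comp _ _ _ snd (fun y : state => y.2 ord0 i)).
  exact: cvg_snd.
apply: (@continuous_comp _ _ _ snd (fun p : 'rV[R]_d => p ord0 i)).
  exact: cvg_snd.
exact: coord_continuous.
Qed.

Lemma test_function_box (theta : R -> R) (s t : R) a b (k : R) : 0 < k ->
  smooth1 theta -> 0 < s -> (forall x, ~~ (s <= x <= t) -> theta x = 0) ->
  0 < a.1 -> test_function (fun x : V => theta x.1 * box_bump a b k x.2).
Proof.
move=> k0 stheta s0 th0 a0; split.
  apply: smooth_class_smooth; apply: smooth_classM.
    by have [dl Dl] := linear_affine time_coord_continuous;
      exact: (smooth_class_comp stheta dl Dl).
  apply: smooth_classM.
    by have [dl Dl] := linear_affine mass_coord_continuous; exact: smooth_class_bump.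
  apply: smooth_class_prod => i.
  by have [dl Dl] := linear_affine (@momentum_coord_continuous i); exact: smooth_class_bump.
exists (`[s, t] `*` (`[a.1, b.1] `*`
  [set p : 'rV[R]_d | forall i, `[a.2 ord0 i, b.2 ord0 i]%classic (p ord0 i)])); split.
- apply: compact_setX; first exact: segment_compact.
  apply: compact_setX; first exact: segment_compact.
  apply: (@rV_compact _ d (fun i => `[a.2 ord0 i, b.2 ord0 i]%classic)) => i.
  exact: segment_compact.
- move=> [x [m p]] [/=]; rewrite !in_itv/= => /andP[sx _] [/andP[am _] _].
  by rewrite /Y/= (lt_le_trans s0)// (lt_le_trans a0).
- move=> [x [m p]] /= K0.
  have [hx|hx] := boolP (s <= x <= t); last by rewrite th0 ?mul0r.
  rewrite /box_bump /=.
  have [hm|hm] := boolP (a.1 < m < b.1); last by rewrite (bump_out k0 hm) mul0r mulr0.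
  have /existsNP[i Hi] : ~ forall i, a.2 ord0 i < p ord0 i < b.2 ord0 i.
    move=> H; apply: K0; move: hm => /andP[h1 h2].
    rewrite !in_itv/= hx (ltW h1) (ltW h2); do 2 split => //.
    by move=> i; have /andP[? ?] := H i; rewrite /= in_itv/= !ltW.
  by rewrite (bigD1 i)//= (bump_out k0 (introN idP Hi)) mul0r !mulr0.
Qed.

End box_bump.

(** * From distributional to integral identities *)

Section real_integrals.
Variable R : realType.
Notation mu := (@lebesgue_measure R).
Implicit Types (f g F : R -> R) (a b s t x : R).

Lemma continuous_integrable f a b : {in `[a, b], continuous f} ->
  mu.-integrable `[a, b] (EFin \o f).
Proof.
move=> cf; apply: continuous_compact_integrable; first exact: segment_compact.
by apply: continuous_in_subspaceT => x; rewrite inE; exact: cf.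
Qed.

Lemma Rintegral_ftc f F a b : a < b -> {in `[a, b], continuous f} ->
  (forall x, a <= x <= b -> derivable F x 1 /\ derive1 F x = f x) ->
  \int[mu]_(x in `[a, b]) f x = F b - F a.
Proof.
move=> ab cf dF; rewrite /Rintegral.
have cF x : a <= x <= b -> F y @[y --> x] --> F x.
  by move=> /dF[+ _] => /derivable1_diffP /differentiable_continuous.
rewrite (@continuous_FTC2 _ f F)//.
- by apply: continuous_in_subspaceT => x; rewrite inE; exact: cf.
- split; first by move=> x; rewrite in_itv/= => /andP[? ?]; apply: (dF _ _).1; rewrite !ltW.
    by apply: cvg_at_right_filter; apply: cF; rewrite lexx ltW.
  by apply: cvg_at_left_filter; apply: cF; rewrite lexx ltW.
- by move=> x; rewrite in_itv/= => /andP[? ?]; apply: (dF _ _).2; rewrite !ltW.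
Qed.

Lemma Rintegral_support f a b (D : set R) : measurable D -> `[a, b] `<=` D ->
  (forall x, ~~ (a <= x <= b) -> f x = 0) ->
  \int[mu]_(x in D) f x = \int[mu]_(x in `[a, b]) f x.
Proof.
move=> mD abD f0; rewrite Rintegral_mkcond [RHS]Rintegral_mkcond.
congr Rintegral; apply/funext => x; rewrite !patchE.
have [xab|xab] := boolP (x \in `[a, b]%classic).
  by rewrite mem_set//; apply: abD; exact: set_mem.
by case: ifP => // _; rewrite f0//; move: xab; rewrite mem_setE in_itv/=.
Qed.

Lemma continuous_derivable f : (forall x, derivable f x 1) -> continuous f.
Proof. by move=> df x; apply: differentiable_continuous; exact/derivable1_diffP. Qed.

Lemma derive_const_le f : (forall x, derivable f x 1) ->
  forall a, (forall x, x < a -> derive1 f x = 0) -> forall x y, x <= a -> y <= a -> f x = f y.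
Proof.
move=> df a f0; wlog : / forall x y, x <= y -> y <= a -> f x = f y.
  move=> H; apply: H => x y xy ya.
  apply/eqP; rewrite eq_le; apply/andP; split.
    apply: (@ger0_derive1_ndecrNy _ _ a) => // [z za|].
      by rewrite f0//; move: za; rewrite in_itv.
    by apply: continuous_subspaceT; exact: continuous_derivable.
  apply: (@ler0_derive1_nincrNy _ _ a) => // [z za|].
    by rewrite f0//; move: za; rewrite in_itv.
  by apply: continuous_subspaceT; exact: continuous_derivable.
by move=> H x y xa ya; have [xy|/ltW yx] := leP x y; [exact: H|exact/esym/H].
Qed.

Lemma derive_const_ge f : (forall x, derivable f x 1) ->
  forall a, (forall x, a < x -> derive1 f x = 0) -> forall x y, a <= x -> a <= y -> f x = f y.
Proof.
move=> df a f0; wlog : / forall x y, a <= x -> x <= y -> f x = f y.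
  move=> H; apply: H => x y xy ya.
  apply/eqP; rewrite eq_le; apply/andP; split.
    apply: (@ger0_derive1_ndecry _ _ a) => // [z za|].
      by rewrite f0//; move: za; rewrite in_itv/= andbT.
    by apply: continuous_subspaceT; exact: continuous_derivable.
  apply: (@ler0_derive1_nincry _ _ a) => // [z za|].
    by rewrite f0//; move: za; rewrite in_itv/= andbT.
  by apply: continuous_subspaceT; exact: continuous_derivable.
by move=> H x y xa ya; have [xy|/ltW yx] := leP x y; [exact: H|exact/esym/H].
Qed.

Lemma bump_primitive (e : R) : 0 < e -> exists B : R -> R,
  (forall x, derivable B x 1) /\ derive1 B = bump 0 e 1.
Proof.
move=> e0; have cb : continuous (bump 0 e 1).
  by apply: continuous_derivable => x; exact: (@smooth1_bump _ _ _ _ 0%N).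
have ib : mu.-integrable setT (EFin \o bump 0 e 1).
  have -> : EFin \o bump 0 e 1 = (EFin \o bump 0 e 1) \_ `[0, e].
    apply/funext => x; rewrite patchE; case: ifPn => // xe /=.
    rewrite bump_out//; apply: contra xe => /andP[x0 xe].
    by rewrite mem_setE in_itv/= !ltW.
  apply: (@integrable_mkcond _ _ _ mu _ (EFin \o bump 0 e 1) (measurable_itv _)).1.
  by apply: continuous_integrable => ? _; exact: cb.
exists (fun x => \int[mu]_(t in `]-oo, x]) bump 0 e 1 t).
have H x : derivable (fun x => \int[mu]_(t in `]-oo, x]) bump 0 e 1 t) x 1 /\
    derive1 (fun x => \int[mu]_(t in `]-oo, x]) bump 0 e 1 t) x = bump 0 e 1 x.
  apply: (@continuous_FTC1 _ (bump 0 e 1) -oo%O x (x + 1)) => //.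
  - by rewrite ltrDl.
  - exact: integrableS ib.
  - by rewrite ltNye_eq.
  - exact: cb.
by split=> [x|]; [exact: (H x).1|apply/funext => x; exact: (H x).2].
Qed.

Let derive1_shift (B : R -> R) c x : derivable B (x - c) 1 ->
  derivable (fun y => B (y - c)) x 1 /\ derive1 (fun y => B (y - c)) x = derive1 B (x - c).
Proof.
move=> dB.
have d1 : is_derive (x - c) 1 B (derive1 B (x - c)).
  by apply: DeriveDef => //; rewrite derive1E.
have d2 : is_derive x 1 (fun y : R => y - c) 1.
  have := is_deriveB (is_derive_id x (1 : R)) (is_derive_cst c x (1 : R)).
  by rewrite subr0.
have d3 := @is_derive1_comp _ B (fun y : R => y - c) x _ _ d1 d2.
by split; [exact: (@ex_derive _ _ _ _ _ _ _ d3)|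
  rewrite derive1E (@derive_val _ _ _ _ _ _ _ d3) mulr1].
Qed.

Let smooth_class_shift (g : R -> R) c : smooth1 g -> smooth_class ((fun x => g (x - c)) : R^o -> R).
Proof.
move=> sg; rewrite (_ : (fun x => _) = fun x => g (1 * (id x - c))).
  by apply: (@smooth_class_scale R R^o id id) => // x v; rewrite derive_id.
by apply/funext => x; rewrite mul1r.
Qed.

Let bump_continuous (e c : R) : continuous (fun x => bump 0 e 1 (x - c)).
Proof.
apply: continuous_derivable => x; apply: (derive1_shift _).1.
exact: (@smooth1_bump _ _ _ _ 0%N).
Qed.

Let bump_difference_primitive (e s t : R) : 0 < e -> s < t -> exists theta,
  [/\ smooth1 theta,
    (forall x, derive1 theta x = bump 0 e 1 (x - s) - bump 0 e 1 (x - t)) &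
    (forall x, ~~ (s < x < t + e) -> theta x = 0)].
Proof.
move=> e0 st; have [B [dB B'E]] := bump_primitive e0.
have dth x : is_derive x 1 (fun x => B (x - s) - B (x - t))
    (bump 0 e 1 (x - s) - bump 0 e 1 (x - t)).
  have [d1 e1] := derive1_shift (dB (x - s)).
  have [d2 e2] := derive1_shift (dB (x - t)).
  apply: DeriveDef; first exact: derivableB.
  by rewrite deriveB// -!derive1E e1 e2 B'E.
have th'E x : derive1 (fun x => B (x - s) - B (x - t)) x =
    bump 0 e 1 (x - s) - bump 0 e 1 (x - t).
  by rewrite derive1E; exact: (@derive_val _ _ _ _ _ _ _ (dth x)).
exists (fun x => B (x - s) - B (x - t)); split; last first.
- have b0 y : ~~ (0 < y < e) -> derive1 B y = 0 by rewrite B'E => ?; exact: bump_out.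
  move=> x; rewrite negb_and -!leNgt => /orP[xs|tx]; apply/eqP; rewrite subr_eq0; apply/eqP.
    apply: (derive_const_le dB (a := 0)).
    + by move=> y y0; apply: b0; apply/negP; lra.
    + by rewrite subr_le0.
    + by rewrite subr_le0 (le_trans xs)// ltW.
  apply: (derive_const_ge dB (a := e)).
  + by move=> y y0; apply: b0; apply/negP; lra.
  + by lra.
  + by lra.
- exact: th'E.
- apply: smooth1_primitive.
    by move=> x; exact: (@ex_derive _ _ _ _ _ _ _ (dth x)).
  apply: smooth_class_smooth1.
  rewrite (_ : derive1 _ = fun x => bump 0 e 1 (x - s) + (-1) * bump 0 e 1 (x - t)).
    apply: smooth_classD; first exact/smooth_class_shift/smooth1_bump.
    apply: smooth_classM; first exact: smooth_class_cst.
    exact/smooth_class_shift/smooth1_bump.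
  by apply/funext => x; rewrite th'E mulN1r.
Qed.

Let bump_mass_gt0 (e s t : R) : 0 < e -> s + e <= t ->
  0 < \int[mu]_(x in `[s, t]) bump 0 e 1 (x - s).
Proof.
move=> e0 st; have [B [dB B'E]] := bump_primitive e0.
have st' : s < t by rewrite (lt_le_trans _ st)// ltrDl.
rewrite (@Rintegral_ftc _ (fun x => B (x - s)) _ _ st'); last 2 first.
- by move=> x _; exact: bump_continuous.
- by move=> x _; rewrite -B'E; exact: derive1_shift.
have -> : B (t - s) = B e.
  apply: (derive_const_ge dB (a := e)) => //; last by rewrite lerBrDl.
  by move=> y y0; rewrite B'E bump_out//; apply/negP; lra.
rewrite subrr subr_gt0; apply: (@gtr0_derive1_lt_cc _ B 0 e).
- by move=> x _; exact: dB.
- by move=> x; rewrite in_itv/= B'E => ?; exact: bump_gt0.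
- by apply: continuous_subspaceT; exact: continuous_derivable.
- by rewrite in_itv/= lexx ltW.
- by rewrite in_itv/= lexx ltW.
- exact: e0.
Qed.

Let bump_average (H : R -> R) (a b c e r del : R) : 0 < e ->
  {in `[a, b], continuous H} ->
  (forall x, c <= x <= c + e -> `|H x - r| <= del) ->
  `|\int[mu]_(x in `[a, b]) (H x * bump 0 e 1 (x - c)) -
    r * \int[mu]_(x in `[a, b]) bump 0 e 1 (x - c)| <=
  del * \int[mu]_(x in `[a, b]) bump 0 e 1 (x - c).
Proof.
move=> e0 cH Hr.
have ib : mu.-integrable `[a, b] (EFin \o (fun x => bump 0 e 1 (x - c))).
  by apply: continuous_integrable => x _; exact: bump_continuous.
have iH : mu.-integrable `[a, b] (EFin \o (fun x => H x * bump 0 e 1 (x - c))).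
  apply: continuous_integrable => x xab.
  by apply: cvgM; [exact: cH|exact: bump_continuous].
have irb : mu.-integrable `[a, b] (EFin \o (fun x => r * bump 0 e 1 (x - c))).
  apply: continuous_integrable => x _.
  by apply: cvgM; [exact: cvg_cst|exact: bump_continuous].
have idb : mu.-integrable `[a, b] (EFin \o (fun x => del * bump 0 e 1 (x - c))).
  apply: continuous_integrable => x _.
  by apply: cvgM; [exact: cvg_cst|exact: bump_continuous].
have iD : mu.-integrable `[a, b]
    (EFin \o (fun x => H x * bump 0 e 1 (x - c) - r * bump 0 e 1 (x - c))).
  apply: continuous_integrable => x xab; apply: cvgB.
    by apply: cvgM; [exact: cH|exact: bump_continuous].
  by apply: cvgM; [exact: cvg_cst|exact: bump_continuous].
have mab : measurable (`[a, b]%classic : set (measurableTypeR R)) by exact: measurable_itv.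
rewrite -(RintegralZl r mab ib) -(RintegralZl del mab ib) -(RintegralB mab iH irb).
apply: (le_trans (le_normr_Rintegral mab iD)).
apply: (le_Rintegral mab (integrable_norm iD) idb) => x _.
rewrite /= -mulrBl normrM [`|bump _ _ _ _|]ger0_norm ?bump_ge0//.
have [h|h] := boolP (0 < x - c < e); last by rewrite bump_out// !mulr0.
rewrite ler_wpM2r ?bump_ge0// Hr//.
by lra.
Qed.

(* du Bois-Reymond *)
Let weak_constant (H : R -> R) : (forall x, 0 < x -> {for x, continuous H}) ->
  (forall theta s t, smooth1 theta -> 0 < s -> s < t ->
    (forall x, ~~ (s < x < t) -> theta x = 0) ->
    \int[mu]_(x in `[s, t]) (H x * derive1 theta x) = 0) ->
  forall s t, 0 < s -> s < t -> H s = H t.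
Proof.
move=> cH weak s t s0 st; have t0 : 0 < t by exact: lt_trans st.
apply/eqP/negPn/negP => Hst.
have [del del0 delE] : exists2 del, 0 < del & 4 * del = `|H s - H t|.
  exists (`|H s - H t| / 4); first by rewrite divr_gt0// normr_gt0 subr_eq0.
  by rewrite mulrC divfK.
have [e e0 [ste He1 He2]] : exists2 e, 0 < e & [/\ s + e <= t,
    (forall x, s <= x <= s + e -> `|H x - H s| <= del) &
    (forall x, t <= x <= t + e -> `|H x - H t| <= del)].
  have := cH _ s0; move/cvgrPdist_le => /(_ _ del0)/nbhs_ballP[e1 /= e10 H1].
  have := cH _ t0; move/cvgrPdist_le => /(_ _ del0)/nbhs_ballP[e2 /= e20 H2].
  have [m m0 [m1 m2 m3]] : exists2 m, 0 < m & [/\ m <= e1, m <= e2 & m <= t - s].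
    exists (Num.min (t - s) (Num.min e1 e2)).
      by rewrite !lt_min e10 e20 subr_gt0 st.
    by rewrite !ge_min !lexx !orbT.
  have near_ball (c r x : R) : m <= r -> c <= x <= c + m / 2 -> ball c r x.
    move=> mr /andP[x1 x2]; rewrite /ball/= distrC ger0_norm ?subr_ge0//.
    by lra.
  exists (m / 2); first by rewrite divr_gt0.
  split.
  - by lra.
  - by move=> x hx; rewrite distrC; apply: H1; exact: near_ball hx.
  - by move=> x hx; rewrite distrC; apply: H2; exact: near_ball hx.
have [th [sth th'E th0]] := bump_difference_primitive e0 st.
have te : s < t + e by rewrite (lt_trans st)// ltrDl.
have cHin : {in `[s, t + e], continuous H}.
  by move=> x; rewrite in_itv/= => /andP[sx _]; apply: cH; exact: lt_le_trans sx.
have mI : measurable (`[s, t + e]%classic : set (measurableTypeR R)) by exact: measurable_itv.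
have iH c : mu.-integrable `[s, t + e] (EFin \o (fun x => H x * bump 0 e 1 (x - c))).
  apply: continuous_integrable => x xab.
  by apply: cvgM; [exact: cHin|exact: bump_continuous].
have ib c : mu.-integrable `[s, t + e] (EFin \o (fun x => bump 0 e 1 (x - c))).
  by apply: continuous_integrable => x _; exact: bump_continuous.
have c0 : 0 < \int[mu]_(x in `[s, t + e]) bump 0 e 1 (x - s).
  by apply: bump_mass_gt0 => //; rewrite (le_trans ste)// lerDl ltW.
have cE : \int[mu]_(x in `[s, t + e]) bump 0 e 1 (x - s) =
    \int[mu]_(x in `[s, t + e]) bump 0 e 1 (x - t).
  apply/eqP; rewrite -subr_eq0 -(RintegralB mI (ib s) (ib t)).
  rewrite (@Rintegral_ftc _ th _ _ te).
  - by rewrite !th0 ?subrr// ltxx ?andbF.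
  - by move=> x _; apply: cvgB; exact: bump_continuous.
  - by move=> x _; split; [exact: (sth 0%N)|exact: th'E].
have HE : \int[mu]_(x in `[s, t + e]) (H x * bump 0 e 1 (x - s)) =
    \int[mu]_(x in `[s, t + e]) (H x * bump 0 e 1 (x - t)).
  apply/eqP; rewrite -subr_eq0 -(RintegralB mI (iH s) (iH t)).
  apply/eqP; rewrite -[RHS](weak th s (t + e) sth s0 te th0).
  by apply: eq_Rintegral => x _; rewrite th'E mulrBr.
have := bump_average e0 cHin He1.
have := bump_average e0 cHin He2.
rewrite -HE -cE.
move: c0; move: (\int[mu]_(x in _) bump _ _ _ _) (\int[mu]_(x in _) (H x * _)) => c J c0 B2 B1.
have h : `|H s - H t| * c <= 2 * (del * c).
  rewrite -(gtr0_norm c0) -normrM mulrBl.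
  apply: (le_trans (ler_distD J _ _)); rewrite distrC mulr2n mulrDl mul1r.
  by apply: lerD; rewrite gtr0_norm.
by move: h; rewrite -delE; have := mulr_gt0 del0 c0; lra.
Qed.

Lemma weak_derivative_ftc (F G : R -> R) : continuous F -> continuous G ->
  (forall theta, smooth1 theta ->
    (exists s t, 0 < s /\ forall x, ~~ (s <= x <= t) -> theta x = 0) ->
    \int[mu]_(x in `]0, +oo[) (F x * derive1 theta x + G x * theta x) = 0) ->
  forall s t, 0 < s -> s < t -> F t - F s = \int[mu]_(x in `[s, t]) G x.
Proof.
move=> cF cG weak s t s0 st.
have [P dP] : exists P : R -> R, forall x, 0 < x -> derivable P x 1 /\ derive1 P x = G x.
  exists (fun x => \int[mu]_(u in `[0, x]) G u) => x x0.
  apply: (@continuous_FTC1_closed _ G 0 x (x + 1)).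
  - by rewrite ltrDl.
  - by apply: continuous_integrable => ? _; exact: cG.
  - exact: x0.
  - exact: cG.
have cP x : 0 < x -> {for x, continuous P}.
  by move=> /dP[+ _] => /derivable1_diffP /differentiable_continuous.
have -> : \int[mu]_(x in `[s, t]) G x = P t - P s.
  apply: (Rintegral_ftc st); first by move=> ? _; exact: cG.
  by move=> x /andP[sx _]; apply: dP; exact: lt_le_trans sx.
suff : F s - P s = F t - P t by lra.
apply: (@weak_constant (fun x => F x - P x)) => //.
  by move=> x x0; apply: cvgB; [exact: cF|exact: cP].
move=> th a b sth a0 ab th0.
have mab : measurable (`[a, b]%classic : set (measurableTypeR R)) by exact: measurable_itv.
have ab0 x : x \in `[a, b] -> 0 < x.
  by rewrite in_itv/= => /andP[ax _]; exact: lt_le_trans ax.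
have cth : continuous th by apply: continuous_derivable; exact: (sth 0%N).
have cth' : continuous (derive1 th) by apply: continuous_derivable; exact: (sth 1%N).
have th0' x : ~~ (a <= x <= b) -> th x = 0.
  by move=> h; apply: th0; apply: contra h => /andP[? ?]; rewrite !ltW.
have th'0 x : ~~ (a <= x <= b) -> derive1 th x = 0.
  rewrite negb_and -!ltNge => /orP[xa|bx]; rewrite derive1E.
    rewrite (@near_eq_derive _ _ _ th (cst 0)) ?derive_cst//.
    near=> y; rewrite th0'// negb_and -!ltNge; apply/orP; left.
    by near: y; exact: lt_nbhsl.
  rewrite (@near_eq_derive _ _ _ th (cst 0)) ?derive_cst//.
  near=> y; rewrite th0'// negb_and -!ltNge; apply/orP; right.
  by near: y; exact: lt_nbhsr.
have iF : mu.-integrable `[a, b] (EFin \o (fun x => F x * derive1 th x + G x * th x)).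
  apply: continuous_integrable => x _.
  by apply: cvgD; apply: cvgM; [exact: cF|exact: cth'|exact: cG|exact: cth].
have iP : mu.-integrable `[a, b] (EFin \o (fun x => P x * derive1 th x + G x * th x)).
  apply: continuous_integrable => x /ab0 x0.
  by apply: cvgD; apply: cvgM; [exact: cP|exact: cth'|exact: cG|exact: cth].
have FE : \int[mu]_(x in `[a, b]) (F x * derive1 th x + G x * th x) = 0.
  rewrite -[RHS](weak th sth); last by exists a, b.
  apply/esym/Rintegral_support; first exact: measurable_itv.
    by move=> x /ab0; rewrite /= in_itv/= andbT.
  by move=> x hx; rewrite th0'// th'0// !mulr0 addr0.
have PE : \int[mu]_(x in `[a, b]) (P x * derive1 th x + G x * th x) = 0.
  rewrite (@Rintegral_ftc _ (fun x => P x * th x) _ _ ab).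
  - by rewrite !th0 ?mulr0 ?subrr// ltxx ?andbF.
  - move=> x /ab0 x0.
    by apply: cvgD; apply: cvgM; [exact: cP|exact: cth'|exact: cG|exact: cth].
  - move=> x /andP[ax _]; have [dPx P'x] := dP x (lt_le_trans a0 ax).
    have dthx : derivable th x 1 by exact: (sth 0%N).
    split; first exact: derivableM.
    by rewrite derive1E deriveM// -!derive1E P'x /GRing.scale/= [th x * _]mulrC.
rewrite -[RHS](subrr 0) -{1}FE -PE -(RintegralB mab iF iP).
by apply: eq_Rintegral => x _; ring.
Unshelve. all: by end_near. Qed.

End real_integrals.

Section product_integral.
Context d (T : measurableType d) (R : realType).
Variable mu : {sigma_finite_measure set T -> \bar R}.
Local Notation mu2 := (mu \x mu)%E.
Implicit Types (u v : T -> R) (h : T * T -> R).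

Lemma ae_eq_integrable (f g : T -> \bar R) : measurable_fun setT g ->
  ae_eq mu setT f g -> mu.-integrable setT f -> mu.-integrable setT g.
Proof.
move=> mg fg /integrableP[mf foo]; apply/integrableP; split => //.
rewrite (ae_eq_integral (abse \o f))//.
- exact: measurableT_comp.
- exact: measurableT_comp.
- exact/ae_eq_comp/ae_eq_sym.
Qed.

Lemma integrable_tensor u v :
  mu.-integrable setT (EFin \o u) -> mu.-integrable setT (EFin \o v) ->
  mu2.-integrable setT (EFin \o (fun z => u z.1 * v z.2)).
Proof.
move=> iu iv.
have mu_ := measurable_int _ iu; have mv := measurable_int _ iv.
apply/integrable12ltyP.
  apply/measurable_EFinP; apply: measurable_funM.
    exact: (measurableT_comp ((measurable_EFinP _ _).1 mu_) measurable_fst).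
  exact: (measurableT_comp ((measurable_EFinP _ _).1 mv) measurable_snd).
have iv' := integrable_abse iv; have iu' := integrable_abse iu.
rewrite (eq_integral (fun x => `|(u x)%:E| * \int[mu]_y `|(v y)%:E|)%E); last first.
  move=> x _; rewrite -integralZl//.
  by apply: eq_integral => y _; rewrite /= normrM EFinM.
rewrite -(fineK (integrable_fin_num measurableT iv')) integralZr//.
by rewrite -(fineK (integrable_fin_num measurableT iu')) -EFinM ltry.
Qed.

Lemma Rintegral_tensor u v :
  mu.-integrable setT (EFin \o u) -> mu.-integrable setT (EFin \o v) ->
  \int[mu2]_z (u z.1 * v z.2) = \int[mu]_x u x * \int[mu]_x v x.
Proof.
move=> iu iv; rewrite /Rintegral.
rewrite -integral12_prod_meas1; last exact: integrable_tensor.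
rewrite [X in fine X = _](eq_integral (fun x => (u x)%:E * \int[mu]_y (v y)%:E)%E); last first.
  move=> x _; rewrite -integralZl//.
have E w : mu.-integrable setT (EFin \o w) ->
    (\int[mu]_y (w y)%:E = (\int[mu]_y w y)%:E)%E.
  by move=> iw; rewrite /Rintegral fineK//; exact: (integrable_fin_num measurableT iw).
by rewrite (E _ iv) integralZr// (E _ iu) -EFinM.
Qed.

Lemma Rintegral_fubini h (psi : T -> R) (C : R) : measurable_fun setT psi ->
  (forall y, `|psi y| <= C) -> mu2.-integrable setT (EFin \o h) ->
  mu.-integrable setT (EFin \o (fun y => \int[mu]_x h (y, x) * psi y)) /\
  \int[mu]_y (\int[mu]_x h (y, x) * psi y) = \int[mu2]_z (h z * psi z.1).
Proof.
move=> mpsi bpsi ih.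
have mh : measurable_fun setT h by apply/measurable_EFinP; exact: measurable_int ih.
have ihp : mu2.-integrable setT (EFin \o (fun z => h z * psi z.1)).
  apply: (le_integrable measurableT _ _ (integrableZl measurableT C ih)).
    apply/measurable_EFinP; apply: measurable_funM => //.
    exact: (measurableT_comp mpsi measurable_fst).
  move=> z _ /=; rewrite lee_fin normrM [leRHS]normrM mulrC ler_wpM2r//.
  exact: le_trans (bpsi _) (ler_norm _).
have iG := integrable_fubini_F ihp.
have aeE : ae_eq mu setT (fubini_F mu (EFin \o (fun z => h z * psi z.1)))
    (EFin \o (fun y => \int[mu]_x h (y, x) * psi y)).
  have := ae_integrable1 ih; apply: filterS => y iy _.
  rewrite /fubini_F/=; under eq_integral do rewrite EFinM.
  rewrite integralZr// EFinM /Rintegral fineK//.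
  exact: (integrable_fin_num measurableT).
have mq : measurable_fun setT (fun y => \int[mu]_x h (y, x)).
  by apply: measurableT_comp => //; exact: (measurable_fubini_F ih).
have mqp : measurable_fun setT (EFin \o (fun y => \int[mu]_x h (y, x) * psi y)).
  by apply/measurable_EFinP; exact: measurable_funM.
split; last first.
  rewrite [RHS]/Rintegral -integral12_prod_meas1//.
  congr fine; apply: ae_eq_integral => //; first exact: measurable_int iG.
  exact: ae_eq_sym.
exact: (ae_eq_integrable mqp aeE iG).
Qed.

Lemma measurable_swap_pair : measurable_fun setT (fun z : T * T => (z.2, z.1)).
Proof. exact/measurable_fun_pair. Qed.

Lemma integrable_swap h : mu2.-integrable setT (EFin \o h) ->
  mu2.-integrable setT (EFin \o (fun z => h (z.2, z.1))).
Proof.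
move=> ih; have mh := measurable_int _ ih.
apply/integrable21ltyP.
  exact: (measurableT_comp mh measurable_swap_pair).
exact: (@integrable12ltyP _ _ _ _ _ mu mu _ mh).1 ih.
Qed.

Lemma Rintegral_swap h : mu2.-integrable setT (EFin \o h) ->
  \int[mu2]_z h (z.2, z.1) = \int[mu2]_z h z.
Proof.
move=> ih; have ih' := integrable_swap ih.
by rewrite /Rintegral -(integral12_prod_meas1 ih) -(integral21_prod_meas1 ih').
Qed.

Lemma measure_preserving_skew (s : T -> T -> T) :
  measurable_fun setT (fun z : T * T => s z.1 z.2) ->
  (forall x, measure_preserving mu (s x)) ->
  measure_preserving mu2 (fun z : T * T => (z.1, s z.1 z.2)).
Proof.
move=> ms sp; split; first by apply/measurable_fun_pair.
move=> A mA; rewrite /= /product_measure1; apply: eq_integral => x _ /=.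
rewrite -[RHS](sp x).2; last exact: measurable_xsection.
by congr (mu _); apply/seteqP; split => y; rewrite /xsection /= !inE.
Qed.

End product_integral.

Section densities.
Variables (R : realType) (d : nat).
Local Notation state := (measurableTypeR R * 'rV[R]_d)%type.
Local Notation mu := (dy_sfinite R d).
Local Notation mu2 := (dy_sfinite R d \x dy_sfinite R d)%E.
Implicit Types (g h u : state -> R) (K : state * state -> R) (psi : state -> R).

Record admissible u : Prop := Admissible {
  adm_out : forall y, ~ Y y -> u y = 0;
  adm_meas : measurable_fun setT u;
  adm_int : mu.-integrable setT (EFin \o (fun y => kS y * u y)) }.

Definition kS_norm u : R := \int[mu]_y `|kS y * u y|.

Lemma admissibleB g h : admissible g -> admissible h -> admissible (fun y => g y - h y).
Proof.
move=> ag ah; split.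
- by move=> y Yy; rewrite (adm_out ag)// (adm_out ah)// subrr.
- by apply: measurable_funB; [exact: adm_meas|exact: adm_meas].
- apply: (eq_integrable measurableT _ _ _ (integrableB measurableT (adm_int ag) (adm_int ah))).
  by move=> y _ /=; rewrite -EFinB mulrBr.
Qed.

Definition pairing K g h : R := \int[mu2]_z (aHS z.1 z.2 * g z.1 * h z.2 * K z).

Lemma pairing_dom K (C : R) g h : admissible g -> admissible h ->
  measurable_fun setT K -> (forall z, `|K z| <= C) ->
  mu2.-integrable setT (EFin \o (fun z => aHS z.1 z.2 * g z.1 * h z.2 * K z)) /\
  `|pairing K g h| <= 8 * C * (kS_norm g * kS_norm h).
Proof.
move=> ag ah mK bK.
have ing := integrable_norm (adm_int ag).
have inh := integrable_norm (adm_int ah).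
have it : mu2.-integrable setT
    (EFin \o (fun z => 8 * C * (`|kS z.1 * g z.1| * `|kS z.2 * h z.2|))).
  exact: (integrableZl measurableT (8 * C) (integrable_tensor ing inh)).
have mz : measurable_fun setT (fun z : state * state => aHS z.1 z.2 * g z.1 * h z.2 * K z).
  apply: measurable_funM => //; apply: measurable_funM; last first.
    exact: (measurableT_comp (adm_meas ah) measurable_snd).
  apply: measurable_funM; first exact: measurable_aHS.
  exact: (measurableT_comp (adm_meas ag) measurable_fst).
have le_z z : `|aHS z.1 z.2 * g z.1 * h z.2 * K z| <=
    8 * C * (`|kS z.1 * g z.1| * `|kS z.2 * h z.2|).
  have C0 : 0 <= C by exact: le_trans (bK z).
  case: (pselect (Y z.1)) => [Y1|nY]; last first.
    by rewrite (adm_out ag nY) !(mulr0, mul0r, normr0).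
  case: (pselect (Y z.2)) => [Y2|nY]; last first.
    by rewrite (adm_out ah nY) !(mulr0, mul0r, normr0).
  move: (aHS_ge0 z.1 z.2) (aHS_le Y1 Y2); move: (aHS z.1 z.2) => A A0 Ale.
  rewrite !normrM (ger0_norm A0).
  rewrite (ger0_norm (le_trans ler01 (kS_ge1 Y1))) (ger0_norm (le_trans ler01 (kS_ge1 Y2))).
  apply: (@le_trans _ _ (8 * (kS z.1 * kS z.2) * `|g z.1| * `|h z.2| * C)).
    rewrite ler_pM ?mulr_ge0//; do 2 rewrite ler_wpM2r//.
  by rewrite le_eqVlt; apply/orP; left; apply/eqP; ring.
have iz : mu2.-integrable setT (EFin \o (fun z => aHS z.1 z.2 * g z.1 * h z.2 * K z)).
  apply: (le_integrable measurableT _ _ it); first exact/measurable_EFinP.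
  by move=> z _; rewrite /= lee_fin (le_trans (le_z z))// ler_norm.
split => //.
apply: (le_trans (le_normr_Rintegral measurableT iz)).
rewrite /kS_norm -(Rintegral_tensor ing inh) -RintegralZl//; last exact: integrable_tensor.
apply: le_Rintegral => //; exact: integrable_norm.
Qed.

Lemma pairing_diff K (C : R) g h : admissible g -> admissible h ->
  measurable_fun setT K -> (forall z, `|K z| <= C) ->
  `|pairing K g g - pairing K h h| <=
    8 * C * (kS_norm (fun y => g y - h y) * (kS_norm g + kS_norm h)).
Proof.
move=> ag ah mK bK; have agh := admissibleB ag ah.
have [i1 b1] := pairing_dom agh ag mK bK.
have [i2 b2] := pairing_dom ah agh mK bK.
have [i3 _] := pairing_dom ag ag mK bK.
have [i4 _] := pairing_dom ah ah mK bK.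
have -> : pairing K g g - pairing K h h =
    pairing K (fun y => g y - h y) g + pairing K h (fun y => g y - h y).
  rewrite /pairing -RintegralD// -RintegralB//.
  by apply: eq_Rintegral => z _; ring.
rewrite (le_trans (ler_normD _ _))//.
by rewrite !mulrDr lerD// [kS_norm (fun _ => _) * kS_norm h]mulrC.
Qed.

Definition pair_shear (z : state * state) : state * state := (z.1, z.1 + z.2).
Definition pair_unshear (z : state * state) : state * state := (z.1, z.2 - z.1).

Lemma shear_preserving :
  measure_preserving mu2 pair_shear /\ measure_preserving mu2 pair_unshear.
Proof.
split.
  apply: measure_preserving_skew; first exact: measurable_addS.
  by move=> x; exact: dy_shift.
apply: (@measure_preserving_skew _ _ _ mu (fun x y => y - x)).
  exact: (measurableT_comp (@measurable_subS R d) (@measurable_swap_pair _ _)).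
move=> x; rewrite (_ : (fun _ => _) = (fun y => - x + y)); first exact: dy_shift.
by apply/funext => y; rewrite addrC.
Qed.

Lemma Rintegral_shear K : \int[mu2]_z K (pair_shear z) = \int[mu2]_z K z.
Proof.
have [s1 s2] := shear_preserving.
congr fine; apply: (@integral_measure_preserving _ _ _ _ _ _ (EFin \o K) s1 s2).
  by move=> [x y]; rewrite /pair_shear /pair_unshear/= [x + y]addrC addrK.
by move=> [x y]; rewrite /pair_shear /pair_unshear/= addrC subrK.
Qed.

End densities.

(** * Weak form of the collision operator *)

Section collision_weak_form.
Variables (R : realType) (d : nat).
Local Notation state := (measurableTypeR R * 'rV[R]_d)%type.
Local Notation mu := (dy_sfinite R d).
Local Notation mu2 := (dy_sfinite R d \x dy_sfinite R d)%E.
Implicit Types (g h u : state -> R) (psi : state -> R).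

Definition restrY u : state -> R := u \_ (@Y R d).

Lemma restrY_in u y : Y y -> restrY u y = u y.
Proof. by move=> yY; rewrite /restrY patchE mem_set. Qed.

Lemma restrY_out u y : ~ Y y -> restrY u y = 0.
Proof. by move=> yY; rewrite /restrY patchE memNset. Qed.

Lemma restrY_admissible u : inL1 (fun y => kS y) u -> admissible (restrY u).
Proof.
move=> iu.
have ik : mu.-integrable setT (EFin \o (fun y => kS y * restrY u y)).
  have := (@integrable_mkcond _ _ _ mu _ _ (@measurable_Y R d)).1 iu.
  congr (_ .-integrable _ _); apply/funext => y; rewrite /= patchE.
  case: ifPn => [/set_mem yY|/negP yY]; first by rewrite restrY_in.
  by rewrite restrY_out ?mulr0// => yY'; apply: yY; exact: mem_set.
split => //; first exact: restrY_out.
have mk : measurable_fun setT (fun y : state => kS y * restrY u y).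
  by apply/measurable_EFinP; exact: measurable_int ik.
rewrite (_ : restrY u = fun y => (kS y)^-1 * (kS y * restrY u y)).
  by apply: measurable_funM => //; exact: (measurableT_comp (@measurable_invr R) (@measurable_kS R d)).
apply/funext => y; have [yY|yY] := pselect (Y y).
  by rewrite mulKf// gt_eqF// (lt_le_trans ltr01)// kS_ge1.
by rewrite restrY_out// !mulr0.
Qed.

Lemma admissible_integrable u psi (C : R) : admissible u ->
  measurable_fun setT psi -> (forall y, Y y -> `|psi y| <= C * kS y) ->
  mu.-integrable setT (EFin \o (fun y => u y * psi y)) /\
  `|\int[mu]_y (u y * psi y)| <= C * kS_norm u.
Proof.
move=> au mpsi bpsi.
have iu := integrable_norm (adm_int au).
have iCu : mu.-integrable setT (EFin \o (fun y => C * `|kS y * u y|)).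
  exact: (integrableZl measurableT C iu).
have le_y y : `|u y * psi y| <= C * `|kS y * u y|.
  have [yY|yY] := pselect (Y y); last first.
    by rewrite (adm_out au yY) !(mul0r, mulr0, normr0).
  rewrite !normrM [`|kS y|]ger0_norm ?(le_trans ler01 (kS_ge1 yY))//.
  by rewrite mulrC mulrA ler_wpM2r// bpsi.
have iup : mu.-integrable setT (EFin \o (fun y => u y * psi y)).
  apply: (le_integrable measurableT _ _ iCu).
    by apply/measurable_EFinP; apply: measurable_funM => //; exact: adm_meas au.
  by move=> y _; rewrite /= lee_fin (le_trans (le_y y))// ler_norm.
split => //; apply: (le_trans (le_normr_Rintegral measurableT iup)).
rewrite /kS_norm -RintegralZl//.
by apply: le_Rintegral => //; exact: integrable_norm.
Qed.

Lemma bounded_le_kS psi (C : R) : (forall y, `|psi y| <= C) ->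
  forall y, Y y -> `|psi y| <= C * kS y.
Proof.
move=> bpsi y yY; rewrite (le_trans (bpsi y))// ler_peMr ?kS_ge1//.
exact: le_trans (bpsi y).
Qed.

Definition weak_kernel psi (z : state * state) : R := 2^-1 * psi (z.1 + z.2) - psi z.1.

Lemma measurable_weak_kernel psi : measurable_fun setT psi ->
  measurable_fun setT (weak_kernel psi).
Proof.
move=> mpsi; apply: measurable_funB.
  by apply: measurable_funM => //; exact: (measurableT_comp mpsi (@measurable_addS R d)).
exact: (measurableT_comp mpsi measurable_fst).
Qed.

Lemma weak_kernel_bounded psi (C : R) : (forall y, `|psi y| <= C) ->
  forall z, `|weak_kernel psi z| <= 2 * C.
Proof.
move=> bpsi z; have C0 : 0 <= C by exact: le_trans (bpsi 0).
rewrite (le_trans (ler_normB _ _))// normrM ger0_norm ?invr_ge0//.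
have := bpsi (z.1 + z.2); have := bpsi z.1; lra.
Qed.

Section gain_loss.
Variables (u : state -> R) (psi : state -> R) (C : R).
Hypotheses (iu : inL1 (fun y => kS y) u).
Hypotheses (mpsi : measurable_fun setT psi) (bpsi : forall y, `|psi y| <= C).
Let w := restrY u.
Let aw : admissible w := restrY_admissible iu.

Let gain y := \int[mu]_x (aHS x (y - x) * w x * w (y - x)).
Let loss y := \int[mu]_x (aHS y x * w y * w x).

Let Q1E y : Y y -> Q1 (@aHS R d) u y = 2^-1 * gain y.
Proof.
move=> yY; rewrite /Q1; congr (_ * _); rewrite Rintegral_mkcond.
congr Rintegral; apply/funext => x; rewrite patchE.
case: ifPn => [/set_mem /= /andP[x0 xy]|].
  by rewrite /w !restrY_in// /Y/= subr_gt0.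
rewrite notin_setE /= => xD.
have [xY|xY] := pselect (Y x); last by rewrite /w (restrY_out _ xY) mulr0 mul0r.
have yxY : ~ Y (y - x).
  by move=> yxY; apply: xD; move: xY yxY; rewrite /Y/= subr_gt0 => -> ->.
by rewrite /w (restrY_out _ yxY) mulr0.
Qed.

Let Q2E y : Y y -> Q2 (@aHS R d) u y = loss y.
Proof.
move=> yY; rewrite /Q2 Rintegral_mkcond.
congr Rintegral; apply/funext => x; rewrite patchE.
case: ifPn => [/set_mem /= xY|]; first by rewrite /w !restrY_in.
by rewrite notin_setE => xY; rewrite /w (restrY_out _ xY) mulr0.
Qed.

Let gain_out y : ~ Y y -> gain y = 0.
Proof.
move=> yY; rewrite /gain; under eq_Rintegral => x _.
  rewrite (_ : _ * _ * _ = 0); first over.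
  have [xY|xY] := pselect (Y x); last by rewrite /w (restrY_out _ xY) mulr0 mul0r.
  have yxY : ~ Y (y - x).
    move=> yxY; apply: yY; move: xY yxY; rewrite /Y/= subr_gt0; exact: lt_trans.
  by rewrite /w (restrY_out _ yxY) mulr0.
by rewrite Rintegral_cst// mul0r.
Qed.

Let loss_out y : ~ Y y -> loss y = 0.
Proof.
move=> yY; rewrite /loss; under eq_Rintegral => x _.
  rewrite (_ : _ * _ * _ = 0); first over.
  by rewrite /w (restrY_out _ yY) mulr0 mul0r.
by rewrite Rintegral_cst// mul0r.
Qed.

Let pairing_int (K : state * state -> R) (D : R) : measurable_fun setT K -> (forall z, `|K z| <= D) ->
  mu2.-integrable setT (EFin \o (fun z => aHS z.1 z.2 * w z.1 * w z.2 * K z)).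
Proof. by move=> mK bK; exact: (pairing_dom aw aw mK bK).1. Qed.

Let loss_weak : mu.-integrable setT (EFin \o (fun y => loss y * psi y)) /\
  \int[mu]_y (loss y * psi y) = pairing (fun z => psi z.1) w w.
Proof.
apply: (@Rintegral_fubini _ _ _ mu (fun z => aHS z.1 z.2 * w z.1 * w z.2) psi C) => //.
have := @pairing_int (cst 1) 1 (measurable_cst _); under eq_fun do rewrite mulr1.
by apply => z; rewrite normr1.
Qed.

Let gain_weak : mu.-integrable setT (EFin \o (fun y => gain y * psi y)) /\
  \int[mu]_y (gain y * psi y) = pairing (fun z => psi (z.1 + z.2)) w w.
Proof.
pose k (z : state * state) := aHS z.1 z.2 * w z.1 * w z.2.
have ik1 := @pairing_int (cst 1) 1 (measurable_cst _) (fun=> eq_ind_r (fun x => x <= 1) (lexx 1) (normr1 R)).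
have ik : mu2.-integrable setT (EFin \o k).
  by move: ik1; under eq_fun do rewrite mulr1.
pose k' z := k (pair_unshear z).
have [s1 s2] := @shear_preserving R d.
have sK : cancel (@pair_shear R d) (@pair_unshear R d).
  by move=> [x y]; rewrite /pair_shear /pair_unshear/= [x + y]addrC addrK.
have s'K : cancel (@pair_unshear R d) (@pair_shear R d).
  by move=> [x y]; rewrite /pair_shear /pair_unshear/= addrC subrK.
have mk : measurable_fun setT k by apply/measurable_EFinP; exact: measurable_int ik.
have ik' : mu2.-integrable setT (EFin \o k').
  apply/integrableP; split.
    by apply/measurable_EFinP; exact: (measurableT_comp mk s2.1).
  rewrite -(integral_measure_preserving (fun z => `|(k' z)%:E|)%E s1 s2 sK s'K).
  rewrite /k'; under eq_integral do rewrite sK.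
  by move/integrableP : ik => [].
have [i1 i2] := Rintegral_fubini mpsi bpsi (integrable_swap ik').
split; first exact: i1.
rewrite [LHS]i2 /=.
have mp2 : measurable_fun setT (fun z : state * state => psi z.2).
  exact: (measurableT_comp mpsi measurable_snd).
have ikp : mu2.-integrable setT (EFin \o (fun z => k' z * psi z.2)).
  apply: (le_integrable measurableT _ _ (integrableZl measurableT C ik')).
    apply/measurable_EFinP; apply: measurable_funM => //.
    exact: (measurableT_comp mk s2.1).
  move=> z _ /=; rewrite lee_fin normrM [leRHS]normrM mulrC ler_wpM2r//.
  exact: le_trans (bpsi _) (ler_norm _).
rewrite (Rintegral_swap ikp) -Rintegral_shear.
by apply: eq_Rintegral => z _; rewrite /k' sK.
Qed.

Lemma weak_form (r q : R) :
  \int[dy R d]_(y in @Y R d) (u y * (r * psi y) + Q (@aHS R d) u y * (q * psi y)) =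
  r * \int[mu]_y (w y * psi y) + q * pairing (weak_kernel psi) w w.
Proof.
have iw := (admissible_integrable aw mpsi (bounded_le_kS bpsi)).1.
have [ig gE] := gain_weak; have [il lE] := loss_weak.
have E1 : \int[dy R d]_(y in @Y R d) (u y * (r * psi y) + Q (@aHS R d) u y * (q * psi y)) =
    \int[mu]_y (r * (w y * psi y) + (q * 2^-1 * (gain y * psi y) - q * (loss y * psi y))).
  rewrite Rintegral_mkcond; congr Rintegral; apply/funext => y; rewrite patchE.
  case: ifPn => [/set_mem /= yY|].
    rewrite /Q Q1E// Q2E// -(restrY_in u yY) -/w; ring.
  rewrite notin_setE => yY; rewrite gain_out// loss_out// /w (restrY_out _ yY).
  by rewrite !(mul0r, mulr0) subr0 addr0.
have iwr := integrableZl measurableT r iw.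
have igr := integrableZl measurableT (q * 2^-1) ig.
have ilr := integrableZl measurableT q il.
rewrite E1 RintegralD//; last by exact: (integrableB measurableT igr ilr).
rewrite RintegralB// !RintegralZl// gE lE; congr (_ + _).
have [i1 _] := @pairing_dom R d (fun z => psi (z.1 + z.2)) C w w aw aw
  (measurableT_comp mpsi (@measurable_addS R d)) (fun=> bpsi _).
have [i2 _] := @pairing_dom R d (fun z => psi z.1) C w w aw aw
  (measurableT_comp mpsi measurable_fst) (fun=> bpsi _).
rewrite -mulrA -mulrBr; congr (_ * _).
rewrite /pairing -RintegralZl// -RintegralB//; last exact: (integrableZl measurableT 2^-1 i1).
by apply: eq_Rintegral => z _; rewrite /weak_kernel; ring.
Qed.

End gain_loss.

End collision_weak_form.

(** * Extension to bounded measurable test functions *)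

Lemma Rintegral_dominated d (T : measurableType d) (R : realType)
    (mu : {measure set T -> \bar R}) (D : set T) (f_ : nat -> T -> R) (f g : T -> R) :
  measurable D -> (forall n, measurable_fun D (f_ n)) ->
  (forall x, D x -> f_ n x @[n --> \oo] --> f x) ->
  mu.-integrable D (EFin \o g) -> (forall n x, D x -> `|f_ n x| <= g x) ->
  \int[mu]_(x in D) f_ n x @[n --> \oo] --> \int[mu]_(x in D) f x.
Proof.
move=> mD mf_ f_f ig f_g.
have mf : measurable_fun D f by exact: (measurable_fun_cvg mf_ f_f).
have [|||||itf _ H] := @dominated_convergence _ _ _ mu D mD
  (fun n => EFin \o f_ n) (EFin \o f) (EFin \o g).
- by move=> n; exact/measurable_EFinP.
- exact/measurable_EFinP.
- by apply: aeW => x Dx; apply: cvg_EFin; [exact: nearW|exact: f_f].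
- exact: ig.
- by apply: aeW => x n Dx; rewrite /= lee_fin f_g.
apply: fine_cvg; rewrite fineK//; exact: (integrable_fin_num mD itf).
Qed.

Section evolution.
Variables (R : realType) (d : nat).
Local Notation state := (measurableTypeR R * 'rV[R]_d)%type.
Local Notation mu := (dy_sfinite R d).
Local Notation mu2 := (dy_sfinite R d \x dy_sfinite R d)%E.
Local Notation leb := (@lebesgue_measure R).
Implicit Types (psi : state -> R).

Variable w : R -> state -> R.
Hypothesis aw : forall t, admissible (w t).
Hypothesis cw : forall t0, kS_norm (fun y => w t y - w t0 y) @[t --> t0] --> (0 : R).

Definition mean psi t : R := \int[mu]_y (w t y * psi y).
Definition rate psi t : R := pairing (weak_kernel psi) (w t) (w t).

Lemma kS_norm_ge0 (u : state -> R) : 0 <= kS_norm u.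
Proof. exact: Rintegral_ge0. Qed.

Lemma mean_continuous psi (C : R) : measurable_fun setT psi ->
  (forall y, Y y -> `|psi y| <= C * kS y) -> continuous (mean psi).
Proof.
move=> mpsi bpsi t0.
apply/cvgrPdist_le => e e0.
have C1 : 0 < `|C| + 1 by rewrite ltr_wpDl.
have := cw t0; move/cvgr0Pnorm_le => /(_ (e / (`|C| + 1)) (divr_gt0 e0 C1)).
apply: filterS => t; rewrite ger0_norm ?kS_norm_ge0// => h.
have [i1 _] := admissible_integrable (aw t) mpsi bpsi.
have [i2 _] := admissible_integrable (aw t0) mpsi bpsi.
have [_ b] := admissible_integrable (admissibleB (aw t) (aw t0)) mpsi bpsi.
rewrite distrC /mean -RintegralB//.
under eq_Rintegral do rewrite -mulrBl.
apply: (le_trans b); move: h; rewrite ler_pdivlMr// mulrC => h.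
apply: (le_trans _ h); rewrite ler_wpM2r ?kS_norm_ge0//.
by rewrite (le_trans (ler_norm _))// lerDl.
Qed.

Lemma rate_continuous psi (C : R) : measurable_fun setT psi ->
  (forall y, `|psi y| <= C) -> continuous (rate psi).
Proof.
move=> mpsi bpsi t0.
have mK := measurable_weak_kernel mpsi; have bK := weak_kernel_bounded bpsi.
have C0 : 0 <= C by exact: le_trans (bpsi 0).
have N_le t : kS_norm (w t) <= kS_norm (fun y => w t y - w t0 y) + kS_norm (w t0).
  have ia := integrable_norm (adm_int (aw t)).
  have ib := integrable_norm (adm_int (aw t0)).
  have ic := integrable_norm (adm_int (admissibleB (aw t) (aw t0))).
  rewrite /kS_norm -RintegralD//; apply: le_Rintegral => //.
    exact: (integrableD measurableT ic ib).
  move=> y _; rewrite -{1}(subrK (w t0 y) (w t y)) mulrDr; exact: ler_normD.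
pose c := 8 * (2 * C) * (1 + 2 * kS_norm (w t0)) + 1.
have c0 : 0 < c.
  by rewrite ltr_wpDl// !mulr_ge0// addr_ge0// mulr_ge0// kS_norm_ge0.
apply/cvgrPdist_le => e e0.
have m0 : 0 < Num.min 1 (e / c) by rewrite lt_min ltr01 divr_gt0.
have := cw t0; move/cvgr0Pnorm_le => /(_ _ m0).
apply: filterS => t; rewrite ger0_norm ?kS_norm_ge0// le_min => /andP[h1 h2].
rewrite distrC; apply: (le_trans (pairing_diff (aw t) (aw t0) mK bK)).
set D := kS_norm (fun y => _) in h1 h2 *.
have D0 : 0 <= D by exact: kS_norm_ge0.
move: h2; rewrite ler_pdivlMr// mulrC => h2; apply: le_trans h2.
rewrite [D * (_ + _)]mulrC (mulrA (8 * (2 * C))) ler_wpM2r// /c.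
apply: (@le_trans _ _ (8 * (2 * C) * (1 + 2 * kS_norm (w t0)))); last by rewrite lerDl.
rewrite ler_wpM2l ?mulr_ge0//; have := N_le t; rewrite -/D; lra.
Qed.

Lemma rate_le psi (C : R) t : measurable_fun setT psi ->
  (forall y, `|psi y| <= C) -> `|rate psi t| <= 16 * C * kS_norm (w t) ^+ 2.
Proof.
move=> mpsi bpsi.
have [_ b] := pairing_dom (aw t) (aw t) (measurable_weak_kernel mpsi) (weak_kernel_bounded bpsi).
by apply: (le_trans b); rewrite le_eqVlt; apply/orP; left; apply/eqP; ring.
Qed.

Lemma kS_norm_continuous : continuous (fun t => kS_norm (w t)).
Proof.
move=> t0; apply/cvgrPdist_le => e e0.
have := cw t0; move/cvgr0Pnorm_le => /(_ _ e0).
apply: filterS => t; rewrite ger0_norm ?kS_norm_ge0// => h.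
have ia := integrable_norm (adm_int (aw t)).
have ib := integrable_norm (adm_int (aw t0)).
have ic := integrable_norm (adm_int (admissibleB (aw t) (aw t0))).
rewrite distrC; apply: le_trans h; rewrite /kS_norm -RintegralB//.
have iab := integrableB measurableT ia ib.
apply: (le_trans (le_normr_Rintegral measurableT iab)).
apply: le_Rintegral => //; first exact: (integrable_norm iab).
by move=> y _; rewrite mulrBr; exact: ler_dist_dist.
Qed.

Definition evolution_identity psi := forall s t, 0 < s -> s < t ->
  mean psi t - mean psi s = \int[leb]_(x in `[s, t]) rate psi x.

Definition testable psi := [/\ measurable_fun setT psi,
  exists C, forall y, `|psi y| <= C & evolution_identity psi].

Lemma testable_ext psi psi' : testable psi -> measurable_fun setT psi' ->
  (exists C, forall y, `|psi' y| <= C) ->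
  (forall y, Y y -> psi' y = psi y) -> testable psi'.
Proof.
move=> [mpsi bpsi ipsi] mpsi' bpsi' E; split => // s t s0 st.
have -> : mean psi' = mean psi.
  apply/funext => x; apply: eq_Rintegral => y _.
  have [yY|yY] := pselect (Y y); first by rewrite E.
  by rewrite (adm_out (aw x) yY) !mul0r.
have -> : rate psi' = rate psi; last exact: ipsi.
apply/funext => x; apply: eq_Rintegral => z _.
have [Y1|Y1] := pselect (Y z.1); last first.
  by rewrite (adm_out (aw x) Y1) !(mul0r, mulr0).
have [Y2|Y2] := pselect (Y z.2); last first.
  by rewrite (adm_out (aw x) Y2) !(mul0r, mulr0).
by rewrite /weak_kernel !E//; exact: YD.
Qed.

Lemma testable_lim (psi_ : nat -> state -> R) psi (C : R) :
  (forall n, testable (psi_ n)) -> (forall n y, `|psi_ n y| <= C) ->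
  (forall y, psi_ n y @[n --> \oo] --> psi y) -> testable psi.
Proof.
move=> gpsi bpsi cpsi.
have mpsi_ n : measurable_fun setT (psi_ n) by have [] := gpsi n.
have mpsi : measurable_fun setT psi.
  by apply: (measurable_fun_cvg mpsi_) => y _; exact: cpsi.
have bpsi' y : `|psi y| <= C.
  have H : `|psi_ n y| @[n --> \oo] --> `|psi y| by apply: cvg_norm; exact: cpsi.
  rewrite -(cvg_lim _ H)//; apply: limr_le; first by apply/cvg_ex; eexists; exact: H.
  by apply: nearW => n; exact: bpsi.
split => //; first by exists C.
have cmean t : mean (psi_ n) t @[n --> \oo] --> mean psi t.
  have iw : mu.-integrable setT (EFin \o (fun y => w t y * C)).
    apply: (@admissible_integrable _ _ (w t) (cst C) `|C| (aw t) _ _).1 => //.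
    by apply: bounded_le_kS => y; exact: lexx.
  apply: (Rintegral_dominated measurableT _ _ (integrable_norm iw)).
  - by move=> n; apply: measurable_funM => //; exact: adm_meas (aw t).
  - by move=> y _; apply: cvgMl_tmp; exact: cpsi.
  - move=> n y _ /=; rewrite !normrM ler_wpM2l//.
    exact: le_trans (bpsi n y) (ler_norm _).
have crate t : rate (psi_ n) t @[n --> \oo] --> rate psi t.
  have [iw _] := @pairing_dom _ _ (cst (2 * C)) `|2 * C| _ _ (aw t) (aw t)
    (measurable_cst _) (fun=> lexx _).
  apply: (Rintegral_dominated measurableT _ _ (integrable_norm iw)).
  - move=> n; apply: measurable_funM; last exact: measurable_weak_kernel.
    apply: measurable_funM; last exact: (measurableT_comp (adm_meas (aw t)) measurable_snd).
    apply: measurable_funM; first exact: measurable_aHS.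
    exact: (measurableT_comp (adm_meas (aw t)) measurable_fst).
  - move=> z _; apply: cvgMl_tmp; apply: cvgB; last exact: cpsi.
    by apply: cvgMl_tmp; exact: cpsi.
  - move=> n z _ /=; rewrite [leLHS]normrM [leRHS]normrM ler_wpM2l//.
    exact: le_trans (weak_kernel_bounded (bpsi n) z) (ler_norm _).
move=> s t s0 st.
have c1 : mean (psi_ n) t - mean (psi_ n) s @[n --> \oo] --> mean psi t - mean psi s.
  exact: cvgB.
have c2 : mean (psi_ n) t - mean (psi_ n) s @[n --> \oo] -->
    \int[leb]_(x in `[s, t]) rate psi x.
  rewrite (_ : (fun n => _) = fun n => \int[leb]_(x in `[s, t]) rate (psi_ n) x); last first.
    by apply/funext => n; have [_ _] := gpsi n; exact.
  pose D : set R := `[s, t]%classic.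
  have ccb : continuous (fun x => 16 * C * kS_norm (w x) ^+ 2).
    move=> x; apply: cvgMl_tmp; rewrite expr2.
    by apply: cvgM; exact: kS_norm_continuous.
  have icc := @continuous_integrable R (fun x => 16 * C * kS_norm (w x) ^+ 2) s t (fun x _ => ccb x).
  apply: (@Rintegral_dominated _ _ R leb D (fun n => rate (psi_ n)) (rate psi) (fun x => 16 * C * kS_norm (w x) ^+ 2)).
  - exact: measurable_itv.
  - move=> n; apply: measurable_funTS; apply: continuous_measurable_fun.
    exact: (rate_continuous (mpsi_ n) (bpsi n)).
  - by move=> x _; exact: crate.
  - exact: icc.
  - by move=> n x _; exact: rate_le.
by rewrite -(cvg_lim _ c1)// -(cvg_lim _ c2).
Qed.

Lemma testableD psi psi' : testable psi -> testable psi' -> testable (fun y => psi y + psi' y).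
Proof.
move=> [m1 [C1 b1] i1] [m2 [C2 b2] i2]; split.
- exact: measurable_funD.
- by exists (C1 + C2) => y; rewrite (le_trans (ler_normD _ _))// lerD.
move=> s t s0 st.
have ME x : mean (fun y => psi y + psi' y) x = mean psi x + mean psi' x.
  have [j1 _] := admissible_integrable (aw x) m1 (bounded_le_kS b1).
  have [j2 _] := admissible_integrable (aw x) m2 (bounded_le_kS b2).
  by rewrite /mean -RintegralD//; apply: eq_Rintegral => y _; rewrite mulrDr.
have RE x : rate (fun y => psi y + psi' y) x = rate psi x + rate psi' x.
  have [j1 _] := pairing_dom (aw x) (aw x) (measurable_weak_kernel m1) (weak_kernel_bounded b1).
  have [j2 _] := pairing_dom (aw x) (aw x) (measurable_weak_kernel m2) (weak_kernel_bounded b2).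
  rewrite /rate /pairing -RintegralD//; apply: eq_Rintegral => y _.
  by rewrite /weak_kernel; ring.
under eq_Rintegral do rewrite RE.
have j1 := @continuous_integrable R (rate psi) s t (fun x _ => @rate_continuous psi C1 m1 b1 x).
have j2 := @continuous_integrable R (rate psi') s t (fun x _ => @rate_continuous psi' C2 m2 b2 x).
by rewrite RintegralD//; rewrite -i1// -i2// !ME; ring.
Qed.

Lemma testableZ c psi : testable psi -> testable (fun y => c * psi y).
Proof.
move=> [m1 [C1 b1] i1]; split.
- exact: measurable_funM.
- by exists (`|c| * C1) => y; rewrite normrM ler_wpM2l.
move=> s t s0 st.
have ME x : mean (fun y => c * psi y) x = c * mean psi x.
  have [j1 _] := admissible_integrable (aw x) m1 (bounded_le_kS b1).
  by rewrite /mean -RintegralZl//; apply: eq_Rintegral => y _; rewrite mulrCA.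
have RE x : rate (fun y => c * psi y) x = c * rate psi x.
  have [j1 _] := pairing_dom (aw x) (aw x) (measurable_weak_kernel m1) (weak_kernel_bounded b1).
  rewrite /rate /pairing -RintegralZl//; apply: eq_Rintegral => y _.
  by rewrite /weak_kernel; ring.
under eq_Rintegral do rewrite RE.
have j1 := @continuous_integrable R (rate psi) s t (fun x _ => @rate_continuous psi C1 m1 b1 x).
by rewrite RintegralZl// -i1// !ME mulrBr.
Qed.

End evolution.

Section generated_test_functions.
Variables (R : realType) (d : nat).
Local Notation state := (measurableTypeR R * 'rV[R]_d)%type.
Implicit Types (psi : state -> R).

Definition orthant (a : state) : set state :=
  [set y : state | a.1 < y.1 /\ forall i, a.2 ord0 i < y.2 ord0 i].

Lemma setI_closed_orthant : setI_closed (range orthant).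
Proof.
move=> _ _ [a _ <-] [b _ <-].
exists (Num.max a.1 b.1, \row_i Num.max (a.2 ord0 i) (b.2 ord0 i)) => //.
apply/seteqP; split => y /=; rewrite /orthant /=.
  rewrite gt_max => -[/andP[a1 b1] ab]; split; split => // i;
  by have := ab i; rewrite mxE gt_max => /andP[].
move=> [[a1 a2] [b1 b2]]; split; first by rewrite gt_max a1.
by move=> i; rewrite mxE gt_max a2 b2.
Qed.

Lemma measurable_orthant a : measurable (orthant a).
Proof.
rewrite (_ : orthant a = (fst @^-1` `]a.1, +oo[%classic) `&`
    (snd @^-1` [set p : 'rV[R]_d | forall i, `]a.2 ord0 i, +oo[%classic (p ord0 i)])).
  apply: measurableI.
    rewrite -[X in measurable X]setTI; apply: measurable_fst => //.
  rewrite -[X in measurable X]setTI; apply: measurable_snd => //.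
  exact: (@measurable_box _ _ (fun i => `]a.2 ord0 i, +oo[%classic)).
apply/seteqP; split => y; rewrite /orthant /=.
  by move=> [a1 a2]; split; [|move=> i]; rewrite /= in_itv/= andbT.
move=> [+ a2]; rewrite in_itv/= andbT => a1; split => // i.
by have := a2 i; rewrite /= in_itv/= andbT.
Qed.

Let above (x : R) : exists k : nat, - k%:R < x.
Proof.
have := archi_boundP (normr_ge0 x) => h; exists (Num.bound `|x|).
by rewrite ltrNl; apply: le_lt_trans h; rewrite -normrN ler_norm.
Qed.

Let above_all (p : 'rV[R]_d) : exists k : nat, forall i, - k%:R < p ord0 i.
Proof.
have /choice[k kP] : forall i : 'I_d, exists k : nat, - k%:R < p ord0 i.
  by move=> i; exact: above.
exists (\max_(i < d) k i)%N => i; apply: le_lt_trans (kP i).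
by rewrite lerN2 ler_nat; exact: (leq_bigmax i).
Qed.

Lemma measurable_orthants : @measurable _ state = <<s range orthant >>.
Proof.
apply/seteqP; split; last first.
  apply: smallest_sub; first exact: sigma_algebra_measurable.
  by move=> _ [a _ <-]; exact: measurable_orthant.
pose T' := g_sigma_algebraType (range orthant).
suff mid : measurable_fun [set: T'] (fun y : T' => y : state).
  by move=> A mA; have := mid measurableT A mA; rewrite setTI.
have mG a : measurable (orthant a : set T').
  by apply: sub_sigma_algebra; exists a.
have -> : (fun y : T' => y : state) = (fun y : T' => (y.1 : measurableTypeR R, y.2)).
  by apply/funext; case.
apply/measurable_fun_pair => /=.
  apply: (measurability _ (RGenOInfty.measurableE R)) => //= _ [_ [c ->] <-].
  rewrite setTI (_ : _ @^-1` _ = \bigcup_k orthant (c, const_mx (- k%:R))).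
    by apply: bigcupT_measurable => k; exact: mG.
  apply/seteqP; split => y /=; rewrite in_itv/= andbT.
    by move=> cy; have [k kP] := above_all y.2; exists k => //; split => // i; rewrite mxE.
  by move=> [k _ []].
apply/measurable_fun_rVP => i.
apply: (measurability _ (RGenOInfty.measurableE R)) => //= _ [_ [c ->] <-].
rewrite setTI (_ : _ @^-1` _ = \bigcup_k
    orthant (- k%:R, \row_j if j == i then c else - k%:R)).
  by apply: bigcupT_measurable => k; exact: mG.
apply/seteqP; split => y /=; rewrite in_itv/= andbT.
  move=> cy; have [k kP] := above_all y.2; have [l lP] := above y.1.
  have kl (x : R) : (- k%:R < x) || (- l%:R < x) -> - (maxn k l)%:R < x.
    by case/orP; apply: le_lt_trans; rewrite lerN2 ler_nat ?leq_maxl ?leq_maxr.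
  exists (maxn k l) => //; split => /=; first by apply: kl; rewrite lP orbT.
  by move=> j; rewrite mxE; case: eqP => [->//|_]; apply: kl; rewrite kP.
by move=> [k _ [_ /(_ i)]]; rewrite mxE eqxx.
Qed.

End generated_test_functions.

Section testable_functions.
Variables (R : realType) (d : nat).
Local Notation state := (measurableTypeR R * 'rV[R]_d)%type.
Implicit Types (psi : state -> R).
Variable w : R -> state -> R.
Hypothesis aw : forall t, admissible (w t).
Hypothesis cw : forall t0, kS_norm (fun y => w t y - w t0 y) @[t --> t0] --> (0 : R).
Hypothesis testable_bump : forall (a b : state) k, 0 < k -> 0 < a.1 -> testable w (box_bump a b k).

Let indic_bounded (A : set state) (y : state) : `|\1_A y : R| <= 1.
Proof. by rewrite indicE; case: (_ \in _); rewrite ?normr1 ?normr0. Qed.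

Let testable_open_box (a b : state) : 0 < a.1 -> testable w \1_(open_box a b).
Proof.
move=> a0; apply: (@testable_lim _ _ _ aw cw (fun n => box_bump a b n.+1%:R) _ 1).
- by move=> n; exact: testable_bump.
- by move=> n y; rewrite ger0_norm ?box_bump_ge0// box_bump_le1.
- by move=> y; exact: box_bump_cvg.
Qed.

Let indic_cvg (A : nat -> set state) (B : set state) :
  (forall y, B y -> \forall n \near \oo, A n y) ->
  (forall n, A n `<=` B) ->
  forall y, \1_(A n) y @[n --> \oo] --> (\1_B y : R).
Proof.
move=> BA AB y; apply: cvg_near_cst.
have [yB|yB] := pselect (B y).
  apply: filterS (BA y yB) => n yA.
  by rewrite !indicE !mem_set.
by apply: nearW => n; rewrite !indicE !memNset// => /AB.
Qed.

Let below_all (p : 'rV[R]_d) : exists k : nat, forall i, p ord0 i < k%:R.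
Proof.
have /choice[k kP] : forall i : 'I_d, exists k : nat, p ord0 i < k%:R.
  move=> i; exists (Num.bound `|p ord0 i|).
  by rewrite (le_lt_trans (ler_norm _))// archi_boundP.
exists (\max_(i < d) k i)%N => i; apply: (lt_le_trans (kP i)).
by rewrite ler_nat; exact: (leq_bigmax i).
Qed.

Let below (x : R) : exists k : nat, x < k%:R.
Proof. by exists (Num.bound `|x|); rewrite (le_lt_trans (ler_norm _))// archi_boundP. Qed.

Let testable_orthant (a : state) : testable w \1_(orthant a).
Proof.
pose A n := open_box (Num.max a.1 n.+1%:R^-1, a.2) (n.+1%:R, const_mx n.+1%:R) : set state.
have gA n : testable w \1_(A n).
  by apply: testable_open_box; rewrite /= lt_max invr_gt0 ltr0n orbT.
have gB : testable w \1_(orthant a `&` @Y R d).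
  apply: (@testable_lim _ _ _ aw cw (fun n => \1_(A n)) _ 1 gA).
    by move=> n y; exact: indic_bounded.
  apply: indic_cvg => [y [[a1 a2] y0]|n y [/= /andP[y1 y2] yi]]; last first.
    move: y1; rewrite gt_max => /andP[a1 y1]; split.
      by split=> // i; have /andP[] := yi i.
    by rewrite /Y/= (lt_trans _ y1)// invr_gt0 ltr0n.
  have [k1 k1P] := below y.1; have [k2 k2P] := below_all y.2.
  have [k3 k3P] := below y.1^-1.
  near=> n; split => /=.
    rewrite gt_max a1/=; apply/andP; split.
      rewrite invf_plt ?posrE ?ltr0n//; apply: (lt_le_trans k3P).
      by rewrite ler_nat ltnW// ltnS; near: n; exact: nbhs_infty_ge.
    apply: (lt_le_trans k1P).
    by rewrite ler_nat ltnW// ltnS; near: n; exact: nbhs_infty_ge.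
  move=> i; rewrite a2/= mxE; apply: (lt_le_trans (k2P i)).
  by rewrite ler_nat ltnW// ltnS; near: n; exact: nbhs_infty_ge.
apply: (testable_ext aw gB) => //.
- by apply: measurable_indic; exact: measurable_orthant.
- by exists 1 => y; exact: indic_bounded.
- move=> y yY; rewrite !indicE; congr (_%:R); congr nat_of_bool.
  by apply/idP/idP; rewrite !inE => //; case.
Unshelve. all: by end_near. Qed.

Let testable_setT : testable w \1_[set: state].
Proof.
apply: (@testable_lim _ _ _ aw cw (fun n => \1_(orthant (- n%:R, const_mx (- n%:R)))) _ 1).
- by move=> n; exact: testable_orthant.
- by move=> n y; exact: indic_bounded.
apply: indic_cvg => // y _.
have [k1 k1P] := below (- y.1); have [k2 k2P] := below_all (- y.2).
near=> n; split => /=.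
  rewrite ltrNl; apply: (lt_le_trans k1P).
  by rewrite ler_nat; near: n; exact: nbhs_infty_ge.
move=> i; rewrite mxE ltrNl; have := k2P i; rewrite mxE => /lt_le_trans; apply.
by rewrite ler_nat; near: n; exact: nbhs_infty_ge.
Unshelve. all: by end_near. Qed.

Let sum_eq_ord (k n : nat) : \sum_(i < n) ((i : nat) == k)%:R = (k < n)%:R :> R.
Proof.
elim: n => [|n IH]; first by rewrite big_ord0.
rewrite big_ord_recr/= IH ltnS [(k <= n)%N]leq_eqVlt [n == k]eq_sym.
by case: ltngtP => _ /=; rewrite ?mulr0n ?mulr1n ?addr0 ?add0r.
Qed.

Lemma testable_indic (A : set state) : measurable A -> testable w \1_A.
Proof.
rewrite [measurable]measurable_orthants; move: A.
apply: (@dynkin_induction _ state (range (@orthant R d)) (fun A => testable w \1_A)).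
- exact: measurable_orthants.
- exact: setI_closed_orthant.
- exact: testable_setT.
- by move=> _ [a _ <-]; exact: testable_orthant.
- move=> A mA gA.
  have := testableD aw cw testable_setT (testableZ aw cw (-1) gA).
  congr testable; apply/funext => y; rewrite !indicE in_setT mulN1r.
  have [yA|yA] := boolP (y \in A).
    by rewrite subrr memNset//=; move: yA; rewrite inE => yA; exact.
  by rewrite subr0 mem_set//=; move: yA; rewrite notin_setE.
- move=> F mF tF gF.
  have sumE n y : \sum_(i < n) \1_(F i) y =
      (\1_(\bigcup_(i in [set i | (i < n)%N]) F i) y : R).
    rewrite indicE; have [[k kn Fky]|nF] := pselect ((\bigcup_(i in [set i | (i < n)%N]) F i) y).
      rewrite mem_set; last by exists k.
      transitivity (\sum_(i < n) ((i : nat) == k)%:R : R); last by rewrite sum_eq_ord kn.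
      apply: eq_bigr => i _; rewrite indicE; congr (_%:R); congr nat_of_bool.
      apply/idP/idP => [|/eqP ->]; last by rewrite inE.
      rewrite inE => Fiy; apply/eqP.
      by apply: (tF i k) => //; exists y.
    rewrite memNset// big1// => i _; rewrite indicE memNset// => Fiy.
    by apply: nF; exists i => //=.
  have gS n : testable w (fun y => \sum_(i < n) \1_(F i) y).
    elim: n => [|n IH].
      have := testableZ aw cw 0 testable_setT; congr testable; apply/funext => y.
      by rewrite big_ord0 mul0r.
    have := testableD aw cw IH (gF n); congr testable; apply/funext => y.
    by rewrite big_ord_recr.
  apply: (testable_lim aw cw gS (C := 1)).
    by move=> n y; rewrite sumE; exact: indic_bounded.
  move=> y; under eq_fun do rewrite sumE.
  apply: indic_cvg => [{}y [k _ Fky]|n {}y [k _ Fky]]; last by exists k.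
  near=> n; exists k => //=; near: n; exact: nbhs_infty_gt.
Unshelve. all: by end_near. Qed.

Import HBNNSimple.

Lemma testable_bounded psi (C : R) : measurable_fun setT psi ->
  (forall y, 0 <= psi y <= C) -> testable w psi.
Proof.
move=> mpsi bpsi.
have mE : measurable_fun setT (EFin \o psi) by exact/measurable_EFinP.
pose h n := nnsfun_approx measurableT mE n.
have hcvg y : (h n y)%:E @[n --> \oo] --> (psi y)%:E.
  apply: (cvg_nnsfun_approx measurableT mE) => // x _.
  by rewrite lee_fin; have /andP[] := bpsi x.
have hcvg' y : h n y @[n --> \oo] --> psi y.
  by have /fine_cvg := hcvg y.
apply: (testable_lim aw cw (psi_ := fun n => h n) (C := C)) => //.
- move=> n; have [s E] : exists s : seq R, (h n : state -> R) = fun y =>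
      \sum_(r <- s) r * \1_(h n @^-1` [set r]) y.
    exists (finmap.enum_fset (fset_set (range (h n)))).
    by apply/funext => y; rewrite {1}(fimfunE (h n)) fsbig_finite.
  rewrite E; elim: s {E} => [|r s IH].
    have := testableZ aw cw 0 testable_setT; congr testable; apply/funext => y.
    by rewrite big_nil mul0r.
  have gr : testable w \1_(h n @^-1` [set r]).
    by apply: testable_indic; exact: measurable_sfunP.
  have := testableD aw cw (testableZ aw cw r gr) IH; congr testable; apply/funext => y.
  by rewrite big_cons.
- move=> n y; rewrite ger0_norm//.
  have /andP[_ yC] := bpsi y; apply: le_trans yC.
  have nd : nondecreasing_seq (fun n => h n y).
    move=> m k mk; have := nd_nnsfun_approx measurableT mE mk.
    by move/lefP; exact.
  rewrite -(cvg_lim _ (hcvg' y))//; apply: nondecreasing_cvgn_le => //.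
  by apply/cvg_ex; eexists; exact: hcvg'.
Qed.

End testable_functions.

(** * Decay of the moment *)

Section moment_inequality.
Variables (R : realType) (d : nat).
Local Notation state := (measurableTypeR R * 'rV[R]_d)%type.
Local Notation mu := (dy_sfinite R d).
Local Notation mu2 := (dy_sfinite R d \x dy_sfinite R d)%E.
Local Notation leb := (@lebesgue_measure R).

Definition phi_min (n : R) (y : state) : R := Num.min (phi y) n.
Definition phi_cut (n : R) (y : state) : R := if phi y <= n then phi y else 0.

Lemma phi_min_ge0 n y : 0 <= n -> 0 <= phi_min n y.
Proof. by move=> n0; rewrite le_min phi_ge0. Qed.

Lemma phi_min_le n y : phi_min n y <= n.
Proof. by rewrite ge_min lexx orbT. Qed.

Lemma phi_cut_ge0 n y : 0 <= phi_cut n y.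
Proof. by rewrite /phi_cut; case: ifP => // _; exact: phi_ge0. Qed.

Lemma phi_cut_le_phi n y : phi_cut n y <= phi y.
Proof. by rewrite /phi_cut; case: ifP => // _; exact: phi_ge0. Qed.

Lemma measurable_phi_min n : measurable_fun setT (phi_min n).
Proof. by apply: measurable_minr => //; exact: measurable_phi. Qed.

Lemma measurable_phi_cut n : measurable_fun setT (phi_cut n).
Proof.
apply: measurable_fun_ifT => //; last exact: measurable_phi.
by apply: measurable_fun_ler => //; exact: measurable_phi.
Qed.

Let defect n (z : state * state) : R :=
  phi_min n z.1 + phi_min n z.2 - phi_min n (z.1 + z.2).

Let defect_ge0 n z : 0 <= n -> Y z.1 -> Y z.2 -> 0 <= defect n z.
Proof.
move=> n0 y1 y2; rewrite subr_ge0 /phi_min.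
have := phi_subadditive y1 y2; have := phi_ge0 z.1; have := phi_ge0 z.2.
move: (phi z.1) (phi z.2) (phi (z.1 + z.2)) => a b c a0 b0 cab.
by rewrite ge_min /Num.min; case: ifP => _; case: ifP => _; apply/orP; [left|right|right|right]; lra.
Qed.

Let defectE n z : 0 <= n -> Y z.1 -> Y z.2 -> phi z.1 <= n -> phi z.2 <= n ->
  defect (2 * n) z = phi z.1 + phi z.2 - phi (z.1 + z.2).
Proof.
move=> n0 y1 y2 h1 h2; rewrite /defect /phi_min.
have := phi_subadditive y1 y2 => h3.
rewrite !min_l//; lra.
Qed.

Let measurable_defect n : measurable_fun setT (defect n).
Proof.
apply: measurable_funB; last exact: (measurableT_comp (measurable_phi_min n) (@measurable_addS R d)).
apply: measurable_funD.
  exact: (measurableT_comp (measurable_phi_min n) measurable_fst).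
exact: (measurableT_comp (measurable_phi_min n) measurable_snd).
Qed.

Let phi_min_norm n y : 0 <= n -> `|phi_min n y| <= n.
Proof. by move=> n0; rewrite ger0_norm ?phi_min_ge0// phi_min_le. Qed.

Let defect_bounded n z : 0 <= n -> `|defect n z| <= 3 * n.
Proof.
move=> n0; rewrite (le_trans (ler_normB _ _))//.
have := ler_normD (phi_min n z.1) (phi_min n z.2).
have := phi_min_norm z.1 n0; have := phi_min_norm z.2 n0.
have := phi_min_norm (z.1 + z.2) n0; lra.
Qed.

Let reflect_snd (z : state * state) : state * state := (z.1, reflect_p z.2).

Let reflect_snd_preserving : measure_preserving mu2 reflect_snd.
Proof.
apply: (@measure_preserving_skew _ _ _ mu (fun _ y => reflect_p y)).
  exact: (measurableT_comp (@dy_reflect R d).1 measurable_snd).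
by move=> x; exact: dy_reflect.
Qed.

Lemma phi_cut_le_kS n y : Y y -> `|phi_cut n y| <= 1 * kS y.
Proof.
move=> yY; rewrite mul1r ger0_norm ?phi_cut_ge0//.
exact: le_trans (phi_cut_le_phi _ _) (phi_le_kS yY).
Qed.

Section even_density.
Variables (g : state -> R) (ag : admissible g).
Hypotheses (g0 : forall y, 0 <= g y) (ge : forall y, g (reflect_p y) = g y).

Lemma pairing_swap (K : state * state -> R) (C : R) : measurable_fun setT K ->
  (forall z, `|K z| <= C) ->
  pairing (fun z => K (z.2, z.1)) g g = pairing K g g.
Proof.
move=> mK bK; have [iK _] := pairing_dom ag ag mK bK.
rewrite /pairing -[RHS](Rintegral_swap iK); apply: eq_Rintegral => z _ /=.
by rewrite (aHS_sym z.2); ring.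
Qed.

Lemma pairing_phi_min_le n : 0 <= n ->
  (\int[mu]_y (g y * phi_cut n y)) ^+ 2 <= - 4 * pairing (weak_kernel (phi_min (2 * n))) g g.
Proof.
move=> n0; have n20 : 0 <= 2 * n by rewrite mulr_ge0.
pose psi := phi_min (2 * n).
have mpsi : measurable_fun setT psi by exact: measurable_phi_min.
have bpsi y : `|psi y| <= 2 * n by exact: phi_min_norm.
have mD := measurable_defect (2 * n).
have bD z := defect_bounded z n20.
have [iD _] := pairing_dom ag ag mD bD.
have kernelE : - 2 * pairing (weak_kernel psi) g g = pairing (defect (2 * n)) g g.
  have m1 : measurable_fun setT (fun z : state * state => psi z.1).
    exact: (measurableT_comp mpsi measurable_fst).
  have m2 : measurable_fun setT (fun z : state * state => psi z.2).
    exact: (measurableT_comp mpsi measurable_snd).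
  have [i1 _] := pairing_dom ag ag m1 (fun z => bpsi z.1).
  have [i2 _] := pairing_dom ag ag m2 (fun z => bpsi z.2).
  have [iK _] := pairing_dom ag ag (measurable_weak_kernel mpsi) (weak_kernel_bounded bpsi).
  have sw := pairing_swap m1 (fun z => bpsi z.1).
  have : pairing (defect (2 * n)) g g =
      (- 2 * pairing (weak_kernel psi) g g + pairing (fun z => psi z.2) g g) -
      pairing (fun z => psi z.1) g g.
    rewrite /pairing -RintegralZl// -RintegralD//; last exact: (integrableZl measurableT (- 2) iK).
    rewrite -RintegralB//; last exact: (integrableD measurableT (integrableZl measurableT (- 2) iK) i2).
    by apply: eq_Rintegral => z _; rewrite /weak_kernel /defect -/psi; field.
  by rewrite sw addrK => ->.
pose F (z : state * state) := aHS z.1 z.2 * g z.1 * g z.2 * defect (2 * n) z.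
have rK : involutive reflect_snd.
  by case=> x y; rewrite /reflect_snd /= reflect_pK.
have iFr : mu2.-integrable setT (EFin \o (F \o reflect_snd)).
  have [mF foo] := integrableP _ _ _ iD; apply/integrableP; split.
    exact: (measurableT_comp mF reflect_snd_preserving.1).
  rewrite (integral_measure_preserving (fun z : state * state => `|(F z)%:E|)%E
    reflect_snd_preserving reflect_snd_preserving rK rK).
  exact: foo.
have FrE : \int[mu2]_z F (reflect_snd z) = pairing (defect (2 * n)) g g.
  congr fine; exact: (integral_measure_preserving (EFin \o F)
    reflect_snd_preserving reflect_snd_preserving rK rK).
have E4 : - 4 * pairing (weak_kernel psi) g g = \int[mu2]_z (F z + F (reflect_snd z)).
  rewrite RintegralD// FrE -[X in _ = X + _]/(pairing (defect (2 * n)) g g) -kernelE.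
  by ring.
rewrite E4 expr2.
have icut := (admissible_integrable ag (measurable_phi_cut n) (fun y => @phi_cut_le_kS n y)).1.
rewrite -(Rintegral_tensor icut icut).
apply: le_Rintegral => //.
- exact: (integrable_tensor icut icut).
- exact: (integrableD measurableT iD iFr).
move=> z _; rewrite /F /reflect_snd /= ge.
have [y1|y1] := pselect (Y z.1); last by rewrite (adm_out ag y1) !(mulr0, mul0r) addr0.
have [y2|y2] := pselect (Y z.2); last by rewrite (adm_out ag y2) !(mulr0, mul0r) addr0.
have d1 := defect_ge0 n20 y1 y2.
have d2 : 0 <= defect (2 * n) (z.1, reflect_p z.2) by exact: defect_ge0.
have rhs0 : 0 <= aHS z.1 z.2 * g z.1 * g z.2 * defect (2 * n) z +
    aHS z.1 (reflect_p z.2) * g z.1 * g z.2 * defect (2 * n) (z.1, reflect_p z.2).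
  by apply: addr_ge0; do 3 (apply: mulr_ge0 => //); exact: aHS_ge0.
rewrite /phi_cut; case: ifPn => [h1|_]; last by rewrite mulr0 mul0r.
case: ifPn => [h2|_]; last by rewrite !mulr0.
rewrite (defectE n0 y1 y2 h1 h2) defectE//; last by rewrite phi_reflect.
have := ler_wpM2l (mulr_ge0 (g0 z.1) (g0 z.2)) (key_inequality y1 y2).
rewrite /= phi_reflect.
move: (phi z.1) (phi z.2) (phi (z.1 + z.2)) (phi (z.1 + reflect_p z.2)) => p q r r' h.
move: h; move: (aHS z.1 z.2) (aHS z.1 (reflect_p z.2)) (g z.1) (g z.2) => a a' u v.
by rewrite !mulrDr; lra.
Qed.

End even_density.
End moment_inequality.

Section moment_decay.
Variables (R : realType) (d : nat).
Local Notation state := (measurableTypeR R * 'rV[R]_d)%type.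
Local Notation mu := (dy_sfinite R d).
Local Notation leb := (@lebesgue_measure R).
Variable w : R -> state -> R.
Hypothesis aw : forall t, admissible (w t).
Hypothesis cw : forall t0, kS_norm (fun y => w t y - w t0 y) @[t --> t0] --> (0 : R).
Hypothesis testable_phi_min : forall n, 0 <= n -> testable w (phi_min n).
Hypothesis even_rep : forall t, exists g : state -> R, [/\ admissible g,
  forall y, 0 <= g y, forall y, g (reflect_p y) = g y &
  kS_norm (fun y => w t y - g y) = 0].

Let rate_phi_min n t : 0 <= n ->
  mean w (phi_cut n) t ^+ 2 <= - 4 * rate w (phi_min (2 * n)) t.
Proof.
move=> n0; have [g [ag g0 ge gw]] := even_rep t.
have n20 : 0 <= 2 * n by rewrite mulr_ge0.
have bpsi (y : state) : `|phi_min (2 * n) y| <= 2 * n.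
  by rewrite ger0_norm ?phi_min_ge0// phi_min_le.
have mpsi := measurable_phi_min (d := d) (2 * n).
have mcut := measurable_phi_cut (d := d) n.
have bcut := @phi_cut_le_kS R d n.
have -> : mean w (phi_cut n) t = \int[mu]_y (g y * phi_cut n y).
  have [i1 _] := admissible_integrable (aw t) mcut bcut.
  have [i2 _] := admissible_integrable ag mcut bcut.
  have [_ b] := admissible_integrable (admissibleB (aw t) ag) mcut bcut.
  apply/eqP; rewrite -subr_eq0 -normr_le0 /mean -RintegralB//.
  move: b; rewrite gw mulr0; apply: le_trans; rewrite le_eqVlt; apply/orP; left.
  by apply/eqP; congr (`|_|); apply: eq_Rintegral => y _; rewrite mulrBl.
have -> : rate w (phi_min (2 * n)) t = pairing (weak_kernel (phi_min (2 * n))) g g.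
  apply/eqP; rewrite -subr_eq0 -normr_le0.
  have := pairing_diff (aw t) ag (measurable_weak_kernel mpsi) (weak_kernel_bounded bpsi).
  by rewrite gw mul0r mulr0.
exact: pairing_phi_min_le.
Qed.

Let phi_le_kS1 (y : state) : Y y -> `|phi y| <= 1 * kS y.
Proof. by move=> yY; rewrite mul1r ger0_norm ?phi_ge0// phi_le_kS. Qed.

Lemma moment_continuous : continuous (mean w (@phi R d)).
Proof. exact: (mean_continuous aw cw (@measurable_phi R d) phi_le_kS1). Qed.

Let phi_norm_integrable t : mu.-integrable setT (EFin \o (fun y => `|w t y * phi y|)).
Proof.
exact: integrable_norm (admissible_integrable (aw t) (@measurable_phi R d) phi_le_kS1).1.
Qed.

Let eventually_above (x : R) : \forall n \near \oo, x <= n%:R.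
Proof.
near=> n; rewrite (le_trans (ler_norm x))// ltW//.
apply: (lt_le_trans (archi_boundP (normr_ge0 x))).
by rewrite ler_nat; near: n; exact: nbhs_infty_ge.
Unshelve. all: by end_near. Qed.

Let mean_phi_min_cvg t :
  mean w (phi_min (2 * n%:R)) t @[n --> \oo] --> mean w (@phi R d) t.
Proof.
apply: (Rintegral_dominated measurableT _ _ (phi_norm_integrable t)).
- by move=> n; apply: measurable_funM; [exact: adm_meas (aw t)|exact: measurable_phi_min].
- move=> y _; apply: cvgMl_tmp; apply: cvg_near_cst.
  apply: filterS (eventually_above (phi y)) => n h.
  by rewrite /phi_min min_l//; have := ler0n R n; lra.
- move=> n y _; rewrite [leLHS]normrM [leRHS]normrM ler_wpM2l//.
  rewrite ger0_norm ?phi_min_ge0 ?mulr_ge0// ger0_norm ?phi_ge0//.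
  by rewrite ge_min lexx.
Qed.

Let mean_phi_cut_cvg t :
  mean w (phi_cut n%:R) t @[n --> \oo] --> mean w (@phi R d) t.
Proof.
apply: (Rintegral_dominated measurableT _ _ (phi_norm_integrable t)).
- by move=> n; apply: measurable_funM; [exact: adm_meas (aw t)|exact: measurable_phi_cut].
- move=> y _; apply: cvgMl_tmp; apply: cvg_near_cst.
  by apply: filterS (eventually_above (phi y)) => n h; rewrite /phi_cut h.
- move=> n y _; rewrite [leLHS]normrM [leRHS]normrM ler_wpM2l//.
  rewrite ger0_norm ?phi_cut_ge0// ger0_norm ?phi_ge0//.
  exact: phi_cut_le_phi.
Qed.

Lemma moment_integral_le s t : 0 < s -> s < t ->
  \int[leb]_(x in `[s, t]) (mean w (@phi R d) x ^+ 2) <=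
  4 * (mean w (@phi R d) s - mean w (@phi R d) t).
Proof.
move=> s0 st.
have mI : measurable (`[s, t]%classic : set (measurableTypeR R)) by exact: measurable_itv.
have csq (f : R -> R) : continuous f -> continuous (fun x : R => f x ^+ 2).
  by move=> cf x; exact: (cvgM (cf x) (cf x)).
have ccut n : continuous (mean w (phi_cut (d := d) n)).
  exact: (mean_continuous aw cw (@measurable_phi_cut R d n) (@phi_cut_le_kS R d n)).
have cN2 : continuous (fun x => kS_norm (w x) ^+ 2).
  by apply: csq; exact: (kS_norm_continuous aw cw).
have iN2 : leb.-integrable `[s, t] (EFin \o (fun x => kS_norm (w x) ^+ 2)).
  by apply: continuous_integrable => x _; exact: cN2.
have c1 : \int[leb]_(x in `[s, t]) (mean w (phi_cut n%:R) x ^+ 2) @[n --> \oo] -->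
    \int[leb]_(x in `[s, t]) (mean w (@phi R d) x ^+ 2).
  apply: (Rintegral_dominated mI _ _ iN2).
  - move=> n; apply: measurable_funTS; apply: continuous_measurable_fun.
    by apply: csq; exact: ccut.
  - by move=> x _; rewrite expr2; apply: cvgM; exact: mean_phi_cut_cvg.
  - move=> n x _; rewrite normrX ler_pXn2r ?nnegrE ?kS_norm_ge0//.
    have [_] := admissible_integrable (aw x) (@measurable_phi_cut R d n%:R) (@phi_cut_le_kS R d n%:R).
    by rewrite mul1r.
have c2 : 4 * (mean w (phi_min (d := d) (2 * n%:R)) s - mean w (phi_min (2 * n%:R)) t) @[n --> \oo] -->
    4 * (mean w (@phi R d) s - mean w (@phi R d) t).
  by apply: cvgMl_tmp; apply: cvgB; exact: mean_phi_min_cvg.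
apply: (ler_cvg_to c1 c2); apply: nearW => n.
have n20 : 0 <= 2 * n%:R :> R by rewrite mulr_ge0.
have bpsi (y : state) : `|phi_min (2 * n%:R) y| <= 2 * n%:R.
  by rewrite ger0_norm ?phi_min_ge0// phi_min_le.
have [mpsi _ id_psi] := testable_phi_min n20.
have crate := rate_continuous aw cw mpsi bpsi.
have irate : leb.-integrable `[s, t] (EFin \o rate w (phi_min (2 * n%:R))).
  by apply: continuous_integrable => x _; exact: crate.
have E : 4 * (mean w (phi_min (d := d) (2 * n%:R)) s - mean w (phi_min (2 * n%:R)) t) =
    \int[leb]_(x in `[s, t]) (- 4 * rate w (phi_min (d := d) (2 * n%:R)) x).
  rewrite RintegralZl// -id_psi//; ring.
rewrite E; apply: le_Rintegral => //.
- by apply: continuous_integrable => x _; apply: csq; exact: ccut.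
- exact: (integrableZl mI (- 4) irate).
- by move=> x _; exact: rate_phi_min.
Qed.

End moment_decay.

Section riccati.
Variable R : realType.
Local Notation leb := (@lebesgue_measure R).
Variable M : R -> R.
Hypothesis cM : continuous M.
Hypothesis dM : forall s t, 0 < s -> s < t ->
  \int[leb]_(x in `[s, t]) (M x ^+ 2) <= 4 * (M s - M t).

Lemma is_derive_inv_sub (z : R -> R) (x dz c : R) : z x != 0 ->
  is_derive x 1 z dz ->
  is_derive x 1 (fun s => (z s)^-1 - c * s) (- (z x) ^- 2 * dz - c).
Proof.
move=> zx0 hz.
have := is_deriveB (is_deriveV zx0 hz) (is_deriveZ c (is_derive_id x (1 : R))).
by move/is_derive_eq; apply; rewrite /GRing.scale/= mulr1.
Qed.

(* [dM] compares [M s] with [M t] only, and [M] need not be differentiable.  But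
   [z s = M t + 1/4 * int_s^t M^2] is: it lies below [M], meets it at [t], and
   satisfies [z' = - M^2 / 4 <= - z^2 / 4]. *)
Lemma riccati_le t : 0 < t -> 0 < M t -> 0 < M 0 /\ (M 0)^-1 + t / 4 <= (M t)^-1.
Proof.
move=> t0 Mt0.
have csq : continuous (fun x : R => M x ^+ 2).
  by move=> x; exact: (cvgM (@cM x) (@cM x)).
have isq a b : leb.-integrable `[a, b] (EFin \o (fun x : R => M x ^+ 2)).
  by apply: continuous_integrable => x _; exact: csq.
have [J dJ] : exists J : R -> R, forall x, -1 < x -> derivable J x 1 /\ derive1 J x = M x ^+ 2.
  exists (fun x => \int[leb]_(u in `[-1, x]) (M u ^+ 2)) => x x0.
  apply: (@continuous_FTC1_closed _ (fun x => M x ^+ 2) (-1) x (x + 1)) => //.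
  - by rewrite ltrDl.
  - exact: csq.
have JE s : 0 < s -> s < t -> \int[leb]_(x in `[s, t]) (M x ^+ 2) = J t - J s.
  move=> s0 st; apply: (Rintegral_ftc st); first by move=> ? _; exact: csq.
  by move=> x /andP[sx _]; apply: dJ; rewrite (lt_trans _ (lt_le_trans s0 sx))// ltrN10.
have cJ (x : R) : -1 < x -> {for x, continuous J}.
  by move=> /dJ[+ _] => /derivable1_diffP /differentiable_continuous.
pose z s := M t + 4^-1 * (J t - J s).
have dz (x : R) : -1 < x -> is_derive x 1 z (- (4^-1 * M x ^+ 2)).
  move=> /dJ[d1 e1].
  have d2 : is_derive x 1 J (M x ^+ 2) by apply: DeriveDef => //; rewrite -derive1E.
  have := is_deriveD (is_derive_cst (M t) x (1 : R))
    (is_deriveZ 4^-1 (is_deriveB (is_derive_cst (J t) x (1 : R)) d2)).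
  by move/is_derive_eq; apply; rewrite add0r sub0r /GRing.scale/= mulrN.
have zE (x : R) : -1 < x -> derivable z x 1 /\ derive1 z x = - (4^-1 * M x ^+ 2).
  move=> x1; have H := dz x x1.
  by split; [exact: (@ex_derive _ _ _ _ _ _ _ H)|rewrite derive1E; exact: (@derive_val _ _ _ _ _ _ _ H)].
have cz (x : R) : -1 < x -> {for x, continuous z}.
  by move=> /zE[+ _] => /derivable1_diffP /differentiable_continuous.
have pos (x : R) : 0 <= x -> -1 < x by move=> x0; rewrite (lt_le_trans _ x0)// ltrN10.
have within (f : R -> R) : (forall x, -1 < x -> {for x, continuous f}) ->
    {within `[0, t], continuous f}.
  move=> cf; apply: continuous_in_subspaceT => x; rewrite inE/= in_itv/= => /andP[x0 _].
  exact/cf/pos.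
have J_le s : 0 <= s -> s <= t -> J s <= J t.
  move=> s0 st; apply: (@ger0_derive1_ndecr _ J 0 t) => //.
  - by move=> x; rewrite in_itv/= => /andP[x0 _]; exact: (dJ x (pos x (ltW x0))).1.
  - by move=> x; rewrite in_itv/= => /andP[x0 _]; rewrite (dJ x (pos x (ltW x0))).2 sqr_ge0.
  - exact: within.
have zt : z t = M t by rewrite /z subrr mulr0 addr0.
have z_gt0 s : 0 <= s -> s <= t -> 0 < z s.
  move=> s0 st; rewrite (lt_le_trans Mt0)// /z lerDl mulr_ge0// subr_ge0.
  exact: J_le.
have z_le s : 0 < s -> s < t -> z s <= M s.
  by move=> s0 st; have := dM s0 st; rewrite (JE _ s0 st) /z; lra.
have z0_le : z 0 <= M 0.
  have c1 : z x @[x --> 0^'+] --> z 0 by apply: cvg_at_right_filter; apply: cz; exact: pos.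
  have c2 : M x @[x --> 0^'+] --> M 0 by apply: cvg_at_right_filter; exact: cM.
  apply: (ler_cvg_to c1 c2); near=> x.
  have x0 : 0 < x by near: x; exact: nbhs_right_gt.
  have xt : x < t by near: x; exact: nbhs_right_lt.
  exact: z_le.
have M0_gt0 : 0 < M 0 by apply: lt_le_trans z0_le; exact: z_gt0 (lexx 0) (ltW t0).
split => //.
pose u s := (z s)^-1 - 4^-1 * s.
have du x : 0 < x -> x < t -> derivable u x 1 /\ 0 <= derive1 u x.
  move=> x0 xt; have zx0 := z_gt0 x (ltW x0) (ltW xt).
  have H := is_derive_inv_sub 4^-1 (lt0r_neq0 zx0) (dz x (pos x (ltW x0))).
  split; first exact: (@ex_derive _ _ _ _ _ _ _ H).
  rewrite derive1E (@derive_val _ _ _ _ _ _ _ H).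
  have -> : - z x ^- 2 * - (4^-1 * M x ^+ 2) - 4^-1 = 4^-1 * ((M x / z x) ^+ 2 - 1).
    by rewrite expr_div_n; ring.
  rewrite mulr_ge0// subr_ge0 exprn_ege1// ler_pdivlMr// mul1r.
  exact: z_le.
have : u 0 <= u t.
  apply: (@ger0_derive1_ndecr _ u 0 t) => //.
  - by move=> x; rewrite in_itv/= => /andP[x0 xt]; exact: (du x x0 xt).1.
  - by move=> x; rewrite in_itv/= => /andP[x0 xt]; exact: (du x x0 xt).2.
  - apply: continuous_in_subspaceT => x; rewrite inE/= in_itv/= => /andP[x0 xt].
    apply: cvgB; last by apply: cvgMl_tmp; exact: cvg_id.
    by apply: cvgV; [rewrite gt_eqF// z_gt0|apply: cz; exact: pos].
  - exact: ltW.
rewrite /u zt mulr0 subr0 => h.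
have : (M 0)^-1 <= (z 0)^-1 by rewrite lef_pV2 ?posrE//; exact: z_gt0 (lexx 0) (ltW t0).
by move: h; lra.
Unshelve. all: by end_near. Qed.

End riccati.

(** * Evenness of solutions *)

Section reflection.
Variables (R : realType) (d : nat).
Local Notation state := (measurableTypeR R * 'rV[R]_d)%type.
Local Notation V := (R * (R * 'rV[R]_d))%type.
Local Notation rho := (@reflect_p R d).

Lemma integral_reflect (D : set state) (h : state -> \bar R) :
  (forall y, D (rho y) <-> D y) ->
  (\int[dy R d]_(y in D) h (rho y) = \int[dy R d]_(y in D) h y)%E.
Proof.
move=> DE; rewrite integral_mkcond [RHS]integral_mkcond.
rewrite -(integral_measure_preserving (h \_ D) (@dy_reflect R d) (@dy_reflect R d)
  (@reflect_pK R d) (@reflect_pK R d)).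
apply: eq_integral => y _; rewrite !patchE.
by congr (if _ then _ else _); apply/idP/idP; rewrite !inE => /DE.
Qed.

Lemma Rintegral_reflect (D : set state) (h : state -> R) :
  (forall y, D (rho y) <-> D y) ->
  \int[dy R d]_(y in D) h (rho y) = \int[dy R d]_(y in D) h y.
Proof. by move=> DE; congr fine; exact: (integral_reflect (EFin \o h)). Qed.

Lemma integrable_reflect (h : state -> R) :
  (dy R d).-integrable (@Y R d) (EFin \o h) ->
  (dy R d).-integrable (@Y R d) (EFin \o (h \o rho)).
Proof.
move=> /integrableP[mh ih]; apply/integrableP; split.
  have mY := @measurable_Y R d.
  apply/(measurable_restrictT _ mY).
  have /(measurable_restrictT _ mY) mh' := mh.
  have := measurableT_comp mh' (@dy_reflect R d).1.
  congr measurable_fun; apply/funext => y; rewrite /= !patchE.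
by rewrite (integral_reflect (fun y => `|(h y)%:E|)%E).
Qed.

Lemma rho_sub y z : rho (y - z) = rho y - rho z.
Proof. by rewrite /reflect_p /= opprB; congr pair; rewrite /= opprK addrC. Qed.

Lemma Q_reflect (u : state -> R) y : Q (@aHS R d) (u \o rho) y = Q (@aHS R d) u (rho y).
Proof.
rewrite /Q /Q1 /Q2; congr (_ * _ - _).
  rewrite -[RHS]Rintegral_reflect; last by []; apply: eq_Rintegral => z _ /=.
  by rewrite -rho_sub aHS_reflect.
rewrite -[RHS]Rintegral_reflect; last by []; apply: eq_Rintegral => z _ /=.
by rewrite aHS_reflect.
Qed.

Definition reflect_t (x : V) : V := (x.1, (x.2.1, - x.2.2)).

Lemma reflect_tK : involutive reflect_t.
Proof. by case=> t [m p]; rewrite /reflect_t /= opprK. Qed.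

Let reflect_t_line h v x : reflect_t (h *: v + x) = h *: reflect_t v + reflect_t x.
Proof. by rewrite /reflect_t /= opprD -scalerN. Qed.

Let growth_reflect (phi : V -> R) v x :
  (fun h => h^-1 *: (((phi \o reflect_t) \o shift x) (h *: v) - (phi \o reflect_t) x)) =
  (fun h => h^-1 *: ((phi \o shift (reflect_t x)) (h *: reflect_t v) - phi (reflect_t x))).
Proof. by apply/funext => h; rewrite /= reflect_t_line. Qed.

Lemma iter_derive_reflect vs (phi : V -> R) :
  iter_derive vs (phi \o reflect_t) = iter_derive (map reflect_t vs) phi \o reflect_t.
Proof.
elim: vs phi => //= v vs IH phi; rewrite -IH; congr iter_derive.
by apply/funext => x; rewrite /derive growth_reflect.
Qed.

Let reflect_t_continuous : continuous reflect_t.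
Proof.
move=> x.
have c1 : y.1 @[y --> x] --> x.1 by exact: cvg_fst.
have c2 : y.2.1 @[y --> x] --> x.2.1.
  by apply: (@continuous_comp _ _ _ snd fst); [exact: cvg_snd|exact: cvg_fst].
have c3 : y.2.2 @[y --> x] --> x.2.2.
  by apply: (@continuous_comp _ _ _ snd snd); exact: cvg_snd.
exact: cvg_pair c1 (cvg_pair c2 (cvgN c3)).
Qed.

Lemma test_function_reflect (phi : V -> R) :
  test_function phi -> test_function (phi \o reflect_t).
Proof.
move=> [sphi [K [cK K0 phiK]]]; split.
  move=> vs; rewrite iter_derive_reflect.
  have [cphi dphi] := sphi (map reflect_t vs); split.
    by move=> x; apply: continuous_comp; [exact: reflect_t_continuous|exact: cphi].
  by move=> x v; rewrite /derivable growth_reflect; exact: dphi.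
exists (reflect_t @` K); split.
- apply: continuous_compact => //.
  by apply: continuous_subspaceT => x; exact: reflect_t_continuous.
- by move=> _ [x /K0 [? ?] <-].
- move=> x nK; apply: phiK => Kx; apply: nK; exists (reflect_t x) => //.
  exact: reflect_tK.
Qed.

Lemma L1norm_reflect (wt u : state -> R) : (forall y, wt (rho y) = wt y) ->
  L1norm wt (u \o rho) = L1norm wt u.
Proof.
move=> wE; rewrite /L1norm -[RHS]integral_reflect//.
by apply: eq_integral => y _; rewrite wE.
Qed.

Lemma inL1_reflect (wt u : state -> R) : (forall y, wt (rho y) = wt y) ->
  inL1 wt u -> inL1 wt (u \o rho).
Proof.
move=> wE iu; have := @integrable_reflect (fun y => wt y * u y) iu.
by congr integrable; apply/funext => y; rewrite /= wE.
Qed.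

Lemma solution_reflect (f_in : state -> R) (f : R -> state -> R) :
  ae_even f_in -> solution (@aHS R d) f_in f ->
  solution (@aHS R d) f_in (fun t => f t \o rho).
Proof.
move=> ein [f0 cf fin df]; split.
- move=> t t0; apply: filterS (measure_preserving_ae (@dy_reflect R d) (f0 t t0)).
  by move=> y /= H yY; exact: H.
- move=> T T0; have [[cf1 cf2] [C bf]] := cf T T0; split.
    split; first by move=> t /cf1; exact: inL1_reflect (@kS_reflect R d).
    move=> t0 /cf2.
    rewrite [X in X @ _ --> _ -> _](_ : _ = fun t =>
      L1norm (@kS R d) (fun y => (f t \o rho) y - (f t0 \o rho) y))//.
    apply/funext => t.
    by rewrite -(@L1norm_reflect (@kS R d) (fun y => f t y - f t0 y) (@kS_reflect R d)).
  exists C; move: bf; apply: filterS; first exact: (ae_filter_ringOfSetsType lebesgue_measure).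
  move=> t bf It; have [i1 b1] := bf It; split.
    by apply: inL1_reflect => // y; rewrite kS_reflect.
  by rewrite L1norm_reflect// => y; rewrite kS_reflect.
- have fin' := measure_preserving_ae (@dy_reflect R d) fin.
  move: fin' ein; apply: filterS2.
  by move=> y h1 h2 yY /=; rewrite h1// -[RHS]h2.
- move=> phi tphi; rewrite -[RHS](df _ (test_function_reflect tphi)).
  apply: eq_Rintegral => t _; rewrite -[RHS]Rintegral_reflect; last by [].
  apply: eq_Rintegral => y _ /=.
  by rewrite Q_reflect /reflect_t/= opprK; case: y.
Qed.

Lemma solution_even (f_in : state -> R) (f : R -> state -> R) t : 0 <= t ->
  ae_even f_in -> unique_solution (@aHS R d) f_in f -> ae_even (f t).
Proof.
move=> t0 ein [sf uf].
exact: (uf _ (solution_reflect ein sf) t t0).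
Qed.

End reflection.

Section solutions.
Variables (R : realType) (d : nat).
Local Notation state := (measurableTypeR R * 'rV[R]_d)%type.
Local Notation mu := (dy_sfinite R d).
Variables (f_in : state -> R) (f : R -> state -> R).
Hypothesis sf : solution (@aHS R d) f_in f.
Hypothesis even_f : forall t, 0 <= t -> ae_even (f t).

(* Even in time, hence continuous on the whole line. *)
Definition flow (t : R) : state -> R := restrY (f `|t|).

Let f_int t : 0 <= t -> inL1 (fun y => kS y) (f t).
Proof.
move=> t0; have [_ cf _ _] := sf.
have t1 : 0 < t + 1 by rewrite ltr_wpDl.
have [[H _] _] := cf _ t1; apply: H.
by rewrite /= in_itv/= t0 ltrDl ltr01.
Qed.

Lemma flow_admissible t : admissible (flow t).
Proof. by apply: restrY_admissible; exact: f_int. Qed.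

Lemma flow_continuous t0 : kS_norm (fun y => flow t y - flow t0 y) @[t --> t0] --> (0 : R).
Proof.
have [_ cf _ _] := sf.
have T0 : 0 < `|t0| + 1 by rewrite ltr_wpDl.
have [[_ H] _] := cf _ T0.
have t0I : `[0, `|t0| + 1[%classic `|t0| by rewrite /= in_itv/= normr_ge0 ltrDl ltr01.
have N t : L1norm (@kS R d) (fun y => f `|t| y - f `|t0| y) =
    (kS_norm (fun y => flow t y - flow t0 y))%:E.
  have ad := admissibleB (flow_admissible t) (flow_admissible t0).
  rewrite /kS_norm /Rintegral fineK; last first.
    exact: (integrable_fin_num measurableT (integrable_norm (adm_int ad))).
  rewrite /L1norm [LHS]integral_mkcond; congr integral; apply/funext => y; rewrite /= patchE.
  case: ifPn => [/set_mem yY|]; first by rewrite /flow !restrY_in.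
  by rewrite notin_setE => yY; rewrite /flow !(restrY_out _ yY) subrr mulr0 normr0.
apply/cvgr0Pnorm_lt => e e0.
have Hc : L1norm (@kS R d) (fun y => f x y - f `|t0| y)
    @[x --> within `[0, `|t0| + 1[ (nbhs `|t0|)] --> (0%R)%:E by exact: H.
have /fine_cvgP[_] := Hc.
move=> /cvgr0Pnorm_lt/(_ e e0).
rewrite /= near_withinE => /nbhs_ballP[r r0 Hr].
apply/nbhs_ballP; exists (Num.min r 1) => /=; first by rewrite lt_min r0 ltr01.
move=> t; rewrite /ball/= lt_min => /andP[h1 h2].
have h3 : `| `|t0| - `|t| | <= `|t0 - t| by exact: ler_dist_dist.
have := Hr `|t|; rewrite /ball/= N /=; apply.
  exact: le_lt_trans h3 h1.
rewrite in_itv/= normr_ge0/=.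
have := le_lt_trans h3 h2; rewrite ltr_norml => /andP[]; lra.
Qed.

Lemma flow_testable_bump (a b : state) k : 0 < k -> 0 < a.1 -> testable flow (box_bump a b k).
Proof.
move=> k0 a0; have mb := @measurable_box_bump R d a b k.
have bb (y : state) : `|box_bump a b k y| <= 1.
  by rewrite ger0_norm ?box_bump_ge0// box_bump_le1.
split => //; first by exists 1.
have [_ _ _ df] := sf.
apply: weak_derivative_ftc.
- exact: (mean_continuous flow_admissible flow_continuous mb (bounded_le_kS bb)).
- exact: (rate_continuous flow_admissible flow_continuous mb bb).
move=> th sth [s [t [s0 th0]]].
rewrite -[RHS](df _ (test_function_box b k0 sth s0 th0 a0)).
apply: eq_Rintegral => x; rewrite inE/= in_itv/= andbT => x0.
have dth (y : state) : derive1 (fun s => th s * box_bump a b k y) x = derive1 th x * box_bump a b k y.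
  by rewrite derive1Mr//; exact: (sth 0%N).
under [RHS]eq_Rintegral do rewrite dth.
rewrite (weak_form (f_int (ltW x0)) mb bb).
by rewrite /mean /rate /flow gtr0_norm// [X in _ = X + _]mulrC [X in _ = _ + X]mulrC.
Qed.

Lemma flow_even_rep t : exists g : state -> R, [/\ admissible g,
  forall y, 0 <= g y, forall y, g (reflect_p y) = g y &
  kS_norm (fun y => flow t y - g y) = 0].
Proof.
have [f0 _ _ _] := sf; have t0 := normr_ge0 t.
have aw := flow_admissible t.
pose g (y : state) := Num.max 0 (2^-1 * (flow t y + flow t (reflect_p y))).
have flow_out y : ~ Y y -> flow t y = 0 by exact: restrY_out.
have gE : ae_eq mu setT (flow t) g.
  have := even_f t0; have := f0 _ t0.
  apply: (@filterS2 _ _ (ae_filter_ringOfSetsType (dy R d))) => y h1 h2 _.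
  have [yY|yY] := pselect (Y y); last first.
    by rewrite /g !flow_out// addr0 mulr0 maxxx.
  rewrite /g /flow !restrY_in// -[reflect_p y]/(y.1, - y.2) h2//.
  have -> : 2^-1 * (f `|t| y + f `|t| y) = f `|t| y by field.
  by rewrite max_r// h1.
have mg : measurable_fun setT g.
  apply: measurable_maxr => //; apply: measurable_funM => //; apply: measurable_funD.
    exact: adm_meas aw.
  exact: (measurableT_comp (adm_meas aw) (@dy_reflect R d).1).
have ag : admissible g.
  split => //.
    by move=> y yY; rewrite /g !flow_out// addr0 mulr0 maxxx.
  apply: (ae_eq_integrable _ _ (adm_int aw)).
    by apply/measurable_EFinP; apply: measurable_funM => //; exact: measurable_kS.
  by move: gE; apply: filterS => y /= /[apply] ->.
exists g; split => //.
- by move=> y; rewrite le_max lexx.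
- by move=> y; rewrite /g reflect_pK addrC.
rewrite /kS_norm /Rintegral (ae_eq_integral (cst 0%E)) ?integral0//.
- exact: measurable_int (integrable_norm (adm_int (admissibleB aw ag))).
- by move: gE; apply: filterS => y /= /[apply] ->; rewrite subrr mulr0 normr0.
Qed.

Lemma flow_moment t : 0 <= t -> moment f t = (mean flow (@phi R d) t)%:E.
Proof.
move=> t0.
have [i _] := @admissible_integrable _ _ _ (@phi R d) 1 (flow_admissible t) (@measurable_phi R d)
  (fun y yY => eq_ind_r (fun z => z <= 1 * kS y)
     (eq_ind_r (fun z => phi y <= z) (phi_le_kS yY) (mul1r (kS y))) (ger0_norm (phi_ge0 y))).
rewrite /mean /Rintegral fineK; last exact: (integrable_fin_num measurableT i).
rewrite /moment [LHS]integral_mkcond; congr integral; apply/funext => y; rewrite /= patchE.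
case: ifPn => [/set_mem yY|]; first by rewrite /flow restrY_in// ger0_norm// mulrC.
by rewrite notin_setE => yY; rewrite /flow restrY_out// mul0r.
Qed.

Lemma flow_testable_phi_min n : 0 <= n -> testable flow (phi_min n).
Proof.
move=> n0; apply: (testable_bounded flow_admissible flow_continuous flow_testable_bump (C := n)).
  exact: measurable_phi_min.
by move=> y; rewrite phi_min_ge0// phi_min_le.
Qed.

Lemma flow_moment_ge0 t : 0 <= mean flow (@phi R d) t.
Proof.
have [g [ag g0 _ gw]] := flow_even_rep t.
have bphi (y : state) : Y y -> `|phi y| <= 1 * kS y.
  by move=> yY; rewrite mul1r ger0_norm ?phi_ge0// phi_le_kS.
have [i1 _] := admissible_integrable (flow_admissible t) (@measurable_phi R d) bphi.
have [i2 _] := admissible_integrable ag (@measurable_phi R d) bphi.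
have [_ b] := admissible_integrable (admissibleB (flow_admissible t) ag) (@measurable_phi R d) bphi.
have -> : mean flow (@phi R d) t = \int[mu]_y (g y * phi y).
  apply/eqP; rewrite -subr_eq0 -normr_le0 /mean -RintegralB//.
  move: b; rewrite gw mulr0; apply: le_trans; rewrite le_eqVlt; apply/orP; left.
  by apply/eqP; congr (`|_|); apply: eq_Rintegral => y _; rewrite mulrBl.
by apply: Rintegral_ge0 => y _; rewrite mulr_ge0// phi_ge0.
Qed.

End solutions.

Theorem lemma3 (R : realType) (d : nat) (f_in : R * 'rV[R]_d -> R)
    (f : R -> R * 'rV[R]_d -> R) :
  (1 <= d)%N ->
  ae_nonneg f_in ->
  inL1 (fun y => kS y ^+ 2) f_in ->
  ae_even f_in ->
  unique_solution (@aHS R d) f_in f ->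
  (moment f 0 < +oo)%E /\
  forall A : \bar R, A^-1%E = moment f 0 ->
  forall t : R, 0 <= t -> (moment f t <= (A + (t / 4)%:E)^-1)%E.
Proof.
move=> _ _ _ ein uf; have [sf _] := uf.
have ef t : 0 <= t -> ae_even (f t) by move=> t0; exact: solution_even ein uf.
have aw := flow_admissible sf; have cw := flow_continuous sf.
have gm := flow_testable_phi_min sf; have er := flow_even_rep sf ef.
set M := mean (flow f) (@phi R d).
have M0 t : 0 <= M t by exact: flow_moment_ge0 sf ef t.
have cM : continuous M by exact: moment_continuous aw cw.
have dM := moment_integral_le aw cw gm er.
have ME t : 0 <= t -> moment f t = (M t)%:E by move=> t0; exact: (flow_moment sf t0).
rewrite ME//; split; first exact: ltry.
move=> A AE t; rewrite le_eqVlt => /predU1P[<-|t0].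
  by rewrite mul0r adde0 AE ME.
rewrite (ME _ (ltW t0)).
have Ht : 0 < M t -> 0 < M 0 /\ (M 0)^-1 + t / 4 <= (M t)^-1.
  exact: (@riccati_le R M cM dM t t0).
move: AE; case: A => [r| |].
- have [->|r0] := eqVneq r 0; first by rewrite inve0.
  rewrite inver (negbTE r0) => -[rE].
  have r_gt0 : 0 < r by rewrite -invr_gt0 lt_neqAle eq_sym invr_eq0 r0 rE M0.
  have rt0 : 0 < r + t / 4 by rewrite addr_gt0// divr_gt0.
  rewrite -EFinD inver gt_eqF// lee_fin.
  have := M0 t; rewrite le_eqVlt => /predU1P[<-|Mt0]; first by rewrite invr_ge0 ltW.
  have [_] := Ht Mt0; rewrite -rE invrK => h.
  by rewrite -[leLHS]invrK lef_pV2// posrE invr_gt0.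
- rewrite invey => -[ME0].
  rewrite lee_fin leNgt; apply/negP => /Ht[].
  by rewrite -ME0 ltxx.
- by rewrite inveNy.
Qed.
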